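(* Every GaTEx graph that contains no induced house is Meyniel, very strongly perfect and brittle.
   Context: All graphs are finite, simple and undirected. A galled-tree on a finite nonempty set $X$ is a directed acyclic graph $N=(V,E)$ such that either $V=X=\{x\}$ and $E=\emptyset$, or: (N1) there is a unique root with indegree 0 and outdegree at least 2; (N2) $x\in X$ iff $x$ has outdegree 0 and indegree 1; (N3) every non-root $v\in V\setminus X$ has either indegree 1 and outdegree at least 2, or indegree 2 and outdegree at least 1 (hybrid-vertex); (N4) each biconnected component $C$ of $N$ contains at most one hybrid-vertex whose two in-neighbours both belong to $C$. For $x,y\in X$, $\mathrm{lca}_N(x,y)$ is the (unique) minimal common ancestor of $x,y$. A labeled galled-tree $(N,t)$ has $t:V\to\{0,1,\odot\}$ with $t(x)=\odot$ iff $x\in X$; it explains the graph on $X$ where $\{x,y\}$ is an edge iff $t(\mathrm{lca}_N(x,y))=1$. A graph is GaTEx if it is isomorphic to a graph explained by some labeled galled-tree. The house is the complement of the path on five vertices. A graph is Meyniel if every odd cycle of length at least five has at least two chords. A graph is very strongly perfect if for every induced subgraph $H$, every vertex of $H$ belongs to a stable set of $H$ meeting all maximal cliques of $H$. A vertex $x$ of $G$ is soft if it is either not a midpoint of any induced $P_4$ of $G$ or not an endpoint of any induced $P_4$ of $G$; $G$ is brittle if every induced subgraph of $G$ has a soft vertex. *)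

(* Defs.v *)
(* A graph on T : finType is a symmetric irreflexive relation. *)
From HB Require Import structures.
From mathcomp Require Import all_boot.

Set Implicit Arguments.
Unset Strict Implicit.
Unset Printing Implicit Defensive.

Section Digraphs.
Variables (V : finType) (E : rel V).

Definition indeg (v : V) : nat := #|[set u | E u v]|.
Definition outdeg (v : V) : nat := #|[set u | E v u]|.

(* [connect E] is reflexive, so loops are excluded too. *)
Definition acyclic : Prop := forall u v, E u v -> ~~ connect E v u.

Definition underlying : rel V := [rel u v | E u v || E v u].

Definition connected_in (A : {set V}) : bool :=
  [forall u in A, forall v in A,
     connect [rel a b | [&& a \in A, b \in A & underlying a b]] u v].

Definition biconnected (C : {set V}) : bool :=
  connected_in C && [forall v, connected_in (C :\ v)].

(* Maximal biconnected subgraphs are induced, hence given by vertex sets;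
   single edges (bridges) are biconnected components. *)
Definition biconnected_component (C : {set V}) : bool := maxset biconnected C.

Definition hybrid (v : V) : bool := (indeg v == 2) && (1 <= outdeg v).

Definition galled_tree (X : {set V}) : Prop :=
  [/\ X != set0, acyclic
    & (exists x, [/\ [set: V] = [set x], X = [set x]
                   & forall u v, ~~ E u v])
      \/
      (exists rt : V,
        [/\ [/\ indeg rt = 0, 2 <= outdeg rt
              & forall v, indeg v = 0 -> v = rt],
            forall x, x \in X <-> outdeg x = 0 /\ indeg x = 1,
            forall v, v != rt -> v \notin X ->
              (indeg v = 1 /\ 2 <= outdeg v) \/ (indeg v = 2 /\ 1 <= outdeg v)
          & forall C, biconnected_component C ->
              #|[set h in C | hybrid h & [set u | E u h] \subset C]| <= 1])].

Definition common_ancestor (x y v : V) : bool := connect E v x && connect E v y.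

(* v is a minimal common ancestor of x and y; for leaves of a galled-tree it is
   unique, i.e. v = lca(x, y). *)
Definition is_lca (x y v : V) : Prop :=
  common_ancestor x y v /\
  forall w, common_ancestor x y w -> connect E v w -> w = v.

End Digraphs.

Inductive label : Type := Zero | One | Odot.

Definition labeled_galled_tree (V : finType) (E : rel V) (X : {set V})
    (t : V -> label) : Prop :=
  galled_tree E X /\ forall v, t v = Odot <-> v \in X.

(* For x = y the lca is the leaf x itself, labeled Odot: no loops arise. *)
Definition explains (V : finType) (E : rel V) (X : {set V}) (t : V -> label)
    (g : rel {x : V | x \in X}) : Prop :=
  forall x y, g x y <-> exists v, is_lca E (val x) (val y) v /\ t v = One.

Definition isomorphic (T U : finType) (e : rel T) (g : rel U) : Prop :=
  exists f : T -> U, bijective f /\ forall x y, e x y = g (f x) (f y).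

Definition GaTEx (T : finType) (e : rel T) : Prop :=
  exists (V : finType) (E : rel V) (X : {set V}) (t : V -> label)
         (g : rel {x : V | x \in X}),
    [/\ labeled_galled_tree E X t, explains E t g & isomorphic e g].

Definition induced_embedding (U T : finType) (h : rel U) (e : rel T)
    (f : U -> T) : Prop :=
  injective f /\ forall i j, h i j = e (f i) (f j).

Definition contains_induced (U T : finType) (h : rel U) (e : rel T) : Prop :=
  exists f : U -> T, induced_embedding h e f.

Definition path_graph (n : nat) : rel 'I_n :=
  [rel i j : 'I_n | (i.+1 == j :> nat) || (j.+1 == i :> nat)].

Definition complement (T : finType) (e : rel T) : rel T :=
  [rel x y | (x != y) && ~~ e x y].

Definition house : rel 'I_5 := complement (@path_graph 5).

Section Graphs.
Variables (T : finType) (e : rel T).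

Definition induced (S : {set T}) : rel {x : T | x \in S} :=
  [rel x y | e (val x) (val y)].

Definition chords (c : seq T) : {set {set T}} :=
  [set [set p.1; p.2] | p : T * T &
     [&& p.1 \in c, p.2 \in c, e p.1 p.2,
         p.2 != next c p.1 & p.1 != next c p.2]].

Definition Meyniel : Prop :=
  forall c : seq T, ucycle e c -> odd (size c) -> 5 <= size c ->
    2 <= #|chords c|.

Definition stable (A : {set T}) : bool :=
  [forall x in A, forall y in A, ~~ e x y].

Definition clique (A : {set T}) : bool :=
  [forall x in A, forall y in A, (x != y) ==> e x y].

Definition maximal_clique (K : {set T}) : bool := maxset clique K.

Definition in_strong_stable_set (v : T) : Prop :=
  exists A : {set T}, [/\ stable A, v \in A
    & forall K, maximal_clique K -> A :&: K != set0].

Definition P4_midpoint (x : T) : Prop :=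
  exists f : 'I_4 -> T, induced_embedding (@path_graph 4) e f /\
    exists i : 'I_4, (i = 1 :> nat \/ i = 2 :> nat) /\ f i = x.

Definition P4_endpoint (x : T) : Prop :=
  exists f : 'I_4 -> T, induced_embedding (@path_graph 4) e f /\
    exists i : 'I_4, (i = 0 :> nat \/ i = 3 :> nat) /\ f i = x.

Definition soft (x : T) : Prop := ~ P4_midpoint x \/ ~ P4_endpoint x.

End Graphs.

Definition very_strongly_perfect (T : finType) (e : rel T) : Prop :=
  forall (S : {set T}) (v : {x : T | x \in S}),
    in_strong_stable_set (@induced T e S) v.

(* The null graph has no vertices at all, hence S is nonempty. *)
Definition brittle (T : finType) (e : rel T) : Prop :=
  forall S : {set T}, S != set0 ->
    exists x : {x : T | x \in S}, soft (@induced T e S) x.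

(* Main.v *)
(* The leaf clusters of a galled tree (the sets of leaves below a vertex) are
   closed under nonempty intersection; clusters overlapping a fixed cluster all
   meet it in the same set; and no three clusters overlap pairwise.  Indeed two
   incomparable vertices with a common descendant lie on a cycle closed by a
   hybrid vertex, and by (N4) two such cycles sharing two vertices have the same
   hybrid vertex.  Adjacency of x and y depends only on which clusters contain
   both.  Set systems with these properties pass to subsets,
     and they force every
   induced subgraph on at least two vertices to be a disjoint union, a join, or
   of the form A + B + H with A-B homogeneous and both A and B built from layers
   over the core H, each layer homogeneous to everything below it.

   By induction on this decomposition every induced subgraph has a vertex that
   is not a midpoint of a P4, whence brittleness.  In particular there are no
   holes of length at least 5, so an odd cycle with at most one chord yields a
   house.  Strong stable sets are glued along the decomposition as well; the
   only obstruction, A complete to B with layers complete to H on both sides,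
   contains a house. *)
Require Import Defs.
From HB Require Import structures.
From mathcomp Require Import all_boot.

Set Implicit Arguments.
Unset Strict Implicit.
Unset Printing Implicit Defensive.

(** * Set systems and graph decompositions *)

Definition overlap (T : finType) (A B : {set T}) : bool :=
  [&& A :&: B != set0, ~~ (A \subset B) & ~~ (B \subset A)].

Lemma overlapC (T : finType) (A B : {set T}) : overlap A B = overlap B A.
Proof. by rewrite /overlap setIC [X in _ && X]andbC. Qed.

Lemma overlapI (T : finType) (A B : {set T}) (x y z : T) :
  x \in A -> x \in B -> y \in A -> y \notin B -> z \in B -> z \notin A ->
  overlap A B.
Proof.
move=> xA xB yA yB zB zA; apply/and3P; split.
- by apply/set0Pn; exists x; rewrite inE xA.
- by apply/subsetPn; exists y.
- by apply/subsetPn; exists z.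
Qed.

Lemma setU_setD (T : finType) (A B : {set T}) :
  A \subset B -> B = A :|: (B :\: A).
Proof. by move=> AB; rewrite -{1}(setID B A) (setIidPr AB). Qed.

Lemma disjoint_setD (T : finType) (A B : {set T}) : [disjoint A & B :\: A].
Proof. by rewrite disjoints_subset setCD subsetUr. Qed.

Lemma setU_setD_id (T : finType) (A H : {set T}) : [disjoint A & H] ->
  (A :|: H) :\: H = A.
Proof.
move=> dAH; apply/setP=> x; rewrite !inE.
by case: (boolP (x \in H)) => xH; rewrite ?orbF //= (disjointFl dAH).
Qed.

Section Decomposition.
Variables (T : finType) (e : rel T).

Definition uniform (b : bool) (P Q : {set T}) : Prop :=
  forall x y, x \in P -> y \in Q -> e x y = b.

(** A layer may carry any graph inside; only its adjacency to what lies further in is prescribed.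
    Inductions peel layers from the outside. *)
Inductive caterpillar (H : {set T}) : {set T} -> Prop :=
| CaterpillarNil : caterpillar H H
| CaterpillarCons (N L : {set T}) (b : bool) :
    L != set0 -> [disjoint L & N] -> uniform b L N ->
    caterpillar H N -> caterpillar H (L :|: N).

Definition splits (S : {set T}) : Prop :=
  exists P Q b, [/\ S = P :|: Q, P != set0, Q != set0, [disjoint P & Q]
    & uniform b P Q].

Definition double_caterpillar (S : {set T}) : Prop :=
  exists A B H b,
    [/\ S = A :|: B :|: H, [/\ A != set0, B != set0 & H != set0],
        [/\ [disjoint A & B], [disjoint A & H] & [disjoint B & H]],
        uniform b A B & caterpillar H (A :|: H) /\ caterpillar H (B :|: H)].

Definition decomposable (S : {set T}) : Prop :=
  splits S \/ double_caterpillar S.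

(* The leaf clusters of a galled tree form such a system, and unlike galled
   trees these systems pass to subsets by taking traces. *)
Record gall_system (S : {set T}) (F : {set {set T}}) : Prop := GallSystem {
  gs_sub : forall A, A \in F -> A \subset S;
  gs_full : S \in F;
  gs_singleton : forall x, x \in S -> [set x] \in F;
  gs_cap : forall A B, A \in F -> B \in F -> A :&: B != set0 -> A :&: B \in F;
  gs_overlap2 : forall A B B', A \in F -> B \in F -> B' \in F ->
    overlap A B -> overlap A B' -> A :&: B = A :&: B';
  gs_overlap3 : forall A B C, A \in F -> B \in F -> C \in F ->
    overlap A B -> overlap A C -> ~~ overlap B C;
  gs_edge : forall x y x' y', x \in S -> y \in S -> x' \in S -> y' \in S ->
    (forall A, A \in F ->
       (x \in A) && (y \in A) = (x' \in A) && (y' \in A)) ->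
    e x y = e x' y' }.

(** Overlapping traces come from overlapping sets, so both overlap axioms are inherited;
    intersections commute with taking traces. *)
Lemma gall_system_trace (S S' : {set T}) (F : {set {set T}}) :
  S' \subset S -> gall_system S F ->
  gall_system S' [set A :&: S' | A in F].
Proof.
move=> sub [Fsub Ffull Fone Fcap F2 F3 Fe].
have ov A B : overlap (A :&: S') (B :&: S') -> overlap A B.
  case/and3P=> /set0Pn[x] /setIP[/setIP[xA _] /setIP[xB _]].
  case/subsetPn=> y /setIP[yA yS]; rewrite inE yS andbT => yB.
  case/subsetPn=> z /setIP[zB zS]; rewrite inE zS andbT => zA.
  exact: overlapI xA xB yA yB zB zA.
have capE A B : (A :&: S') :&: (B :&: S') = (A :&: B) :&: S'.
  by rewrite setIACA setIid.
split.
- by move=> _ /imsetP[A _ ->]; apply: subsetIr.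
- by apply/imsetP; exists S => //; apply/esym/setIidPr.
- move=> x xS; apply/imsetP; exists [set x]; first exact/Fone/(subsetP sub).
  by apply/esym/setIidPl; rewrite sub1set.
- move=> _ _ /imsetP[A FA ->] /imsetP[B FB ->]; rewrite capE => n0.
  apply/imsetP; exists (A :&: B) => //; apply: Fcap => //.
  by apply: contra n0 => /eqP->; rewrite set0I.
- move=> _ _ _ /imsetP[A FA ->] /imsetP[B FB ->] /imsetP[B' FB' ->] /ov o /ov
    o'.
  by rewrite !capE (F2 _ _ _ FA FB FB').
- move=> _ _ _ /imsetP[A FA ->] /imsetP[B FB ->] /imsetP[C FC ->] /ov o /ov o'.
  by apply: contra (F3 _ _ _ FA FB FC o o') => /ov.
- move=> x y x' y' xS yS x'S y'S eqA.
  apply: Fe; rewrite ?(subsetP sub) // => A FA.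
  by have := eqA _ (imset_f _ FA); rewrite !inE xS yS x'S y'S !andbT.
Qed.

(** * Decomposing the ground set of a gall system *)

Section GallSystem.
Variables (S : {set T}) (F : {set {set T}}).
Hypothesis sys : gall_system S F.

Definition spans (x y : T) (N : {set T}) : Prop :=
  forall A, A \in F -> x \in A -> y \in A -> N \subset A.

(** For every such pair the members of [F] containing the pair are exactly those containing [N], so
    [gs_edge] gives all pairs the same adjacency. *)
Lemma spans_uniform (P Q N : {set T}) :
  P != set0 -> Q != set0 -> P \subset N -> Q \subset N -> N \subset S ->
  (forall x y, x \in P -> y \in Q -> spans x y N) ->
  exists b, uniform b P Q.
Proof.
move=> /set0Pn[x0 x0P] /set0Pn[y0 y0Q] /subsetP PN /subsetP QN /subsetP NS sp.
exists (e x0 y0) => x y xP yQ; apply: (gs_edge sys).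
- exact/NS/PN.
- exact/NS/QN.
- exact/NS/PN.
- exact/NS/QN.
move=> A FA; apply/andP/andP=> -[hx hy].
  have /subsetP sA := sp _ _ xP yQ A FA hx hy.
  by split; apply: sA; [apply: PN | apply: QN].
have /subsetP sA := sp _ _ x0P y0Q A FA hx hy.
by split; apply: sA; [apply: PN | apply: QN].
Qed.

(** The outermost layer is [N :\: N'], where [N'] is a maximal member of [F] containing [H] and
    properly inside [N]. It is homogeneous to [N'] because a member of [F] meeting both must contain
    [N], by the overlap axioms applied with [M2]. *)
Lemma overlap_caterpillar (M1 M2 : {set T}) :
  M1 \in F -> M2 \in F -> overlap M1 M2 ->
  forall N, N \in F -> M1 :&: M2 \subset N -> N \subset M1 ->
  caterpillar (M1 :&: M2) N.
Proof.
move=> FM1 FM2 o12; set H := M1 :&: M2.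
have /and3P[H0 n12 n21] := o12; have FH : H \in F by apply: (gs_cap sys).
have /set0Pn[h hH] := H0.
have [/subsetP HM1 /subsetP HM2] : H \subset M1 /\ H \subset M2.
  by split; [apply: subsetIl | apply: subsetIr].
have /subsetPn[m mM2 mM1] := n21.
(* [M2] sticks out of [M1], so a subset of [M1] overlaps [M2] as soon as it meets [M2] and leaves
   it. *)
have ovM2 (A : {set T}) x : x \in A -> x \notin M2 -> A \subset M1 ->
  A :&: M2 != set0 ->
    overlap A M2.
  move=> xA xM2 /subsetP AM1 /set0Pn[y] /setIP[yA yM2].
  by apply: (overlapI yA yM2 xA xM2 mM2); apply: contra mM1; apply: AM1.
move=> N; have [n] := ubnP #|N|; elim: n N => // n IHn N.
move=> leN FN HN NM1; have [-> | neN] := eqVneq N H;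
  first exact: CaterpillarNil.
pose P (A : {set T}) := [&& A \in F, H \subset A & A \proper N].
have PH : P H by rewrite /P FH subxx properEneq eq_sym neN.
have [N' maxN' _] := maxset_exists PH.
have /maxsetP[/and3P[FN' HN' ltN'] max'] := maxN'.
have /andP[N'N nNN'] := ltN'.
have defN : N = (N :\: N') :|: N' by rewrite setUC -setU_setD.
have L0 : N :\: N' != set0 by rewrite setD_eq0.
have N'0 : N' != set0 by apply/set0Pn; exists h; apply: (subsetP HN').
have NS := gs_sub sys FN.
have sp x y : x \in N :\: N' -> y \in N' -> spans x y N.
  case/setDP=> xN xN' yN' z Fz xz yz; set w := z :&: N.
  suff eqw : N = w by rewrite eqw subsetIl.
  have yN := subsetP N'N _ yN'.
  have xw : x \in w by rewrite inE xz.
  have yw : y \in w by rewrite inE yz.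
  have Fw : w \in F by apply: (gs_cap sys) => //; apply/set0Pn; exists y.
  have wM1 : w \subset M1 by apply: subset_trans NM1; apply: subsetIr.
  have xM2 : x \notin M2.
    apply: contra xN' => xM2; apply: (subsetP HN').
    by rewrite inE xM2 (subsetP NM1).
  have ovN' u : u \in N' -> u \notin M2 -> overlap M2 N'.
    move=> uN' uM2; rewrite overlapC; apply: (ovM2 _ u) => //.
      exact: subset_trans N'N NM1.
    by apply/set0Pn; exists h; rewrite inE (subsetP HN') ?HM2.
  (* If [w] misses [M2], then [N'] overlaps both [w] and [M2], hence meets them in the same set; but
     [y] lies in [w] and not in [M2]. *)
  have [w0 | ww] := boolP (w :&: M2 == set0).
    have disj u : u \in w -> u \notin M2.
      by move=> uw; apply/negP=> uM2; move/eqP/setP/(_ u): w0;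
        rewrite !inE uM2 -in_setI uw.
    have hw : h \notin w by apply: contraL (HM2 _ hH); apply: disj.
    have o1 : overlap N' w := overlapI yN' yw (subsetP HN' _ hH) hw xw xN'.
    have o2 : overlap N' M2 by rewrite overlapC; apply: ovN' yN' (disj _ yw).
    have /setP/(_ y) := gs_overlap2 sys FN' Fw FM2 o1 o2.
    by rewrite !inE yN' yz yN (negPf (disj _ yw)).
  have ow : overlap M2 w by rewrite overlapC; apply: (ovM2 _ x).
  have Hw : H \subset w.
    have o21 : overlap M2 M1 by rewrite overlapC.
    by rewrite /H setIC (gs_overlap2 sys FM2 FM1 Fw o21 ow) subsetIr.
  (* Now [w] contains [H]. Were it smaller than [N], maximality of [N'] would make [M2], [w] and
     [N'] overlap pairwise. *)
  apply/eqP/negPn/negP=> Nw.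
  have ltw : w \proper N by rewrite properEneq subsetIr eq_sym Nw.
  have nN'w : ~~ (N' \subset w).
    apply/negP=> sN'w; have defw : w = N' by apply: max' => //; apply/and3P.
    by rewrite -defw xw in xN'.
  have /subsetPn[u uN' uw] := nN'w.
  have uM2 : u \notin M2.
    apply: contra uw => uM2; apply: (subsetP Hw); rewrite inE uM2 andbT.
    by apply: (subsetP NM1); apply: (subsetP N'N).
  have := gs_overlap3 sys FM2 Fw FN' ow (ovN' _ uN' uM2).
  by rewrite (overlapI yw yN' xw xN' uN' uw).
have [b ub] := spans_uniform L0 N'0 (subsetDl _ _) N'N NS sp.
rewrite defN; apply: (CaterpillarCons (b := b)) => //.
  by rewrite disjoint_sym disjoint_setD.
apply: IHn => //; first exact: leq_trans (proper_card ltN') leN.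
exact: subset_trans N'N NM1.
Qed.

(** Fix a maximal proper member [M1] of [F]. If no other one overlaps it, [M1] splits off. If [M2]
    does, either [M1 :|: M2] splits off, or it is all of [S] and [M1 :&: M2] is the core of a double
    caterpillar. *)
Lemma gall_system_decomposable : 1 < #|S| -> decomposable S.
Proof.
move=> S2; pose P (A : {set T}) := (A \in F) && (A != S).
have ex x : x \in S -> P [set x].
  move=> xS; rewrite /P (gs_singleton sys xS) /=.
  by apply/eqP=> dS; rewrite -dS cards1 in S2.
have [x0 x0S] : exists x, x \in S by apply/set0Pn; rewrite -card_gt0 ltnW.
have [M1 max1 _] := maxset_exists (ex _ x0S).
have maxov (M M' : {set T}) x y : maxset P M -> maxset P M' -> x \in M ->
  x \in M' ->
    y \in M' -> y \notin M -> overlap M M'.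
  move=> /maxsetP[PM mM] /maxsetP[PM' mM'] xM xM' yM' yM.
  apply/and3P; split; first by apply/set0Pn; exists x; rewrite inE xM.
    by apply: contra yM => /(mM _ PM') <-.
  by apply: contra yM => /(mM' _ PM) ->.
(* Points in no common maximal proper member lie together only in [S] itself. *)
have big (z : {set T}) x y (M : {set T}) : z \in F -> x \in z -> y \in z ->
  x \in M -> y \notin M ->
   (forall M', maxset P M' -> x \in M' -> y \in M' -> False) -> S \subset z.
  move=> Fz xz yz xM yM noM; case: (eqVneq z S) => [-> // | nz].
  have [|M' max' zM'] := @maxset_exists _ P z; first by rewrite /P Fz.
  by case: (noM M'); rewrite ?(subsetP zM').
have /maxsetP[/andP[F1 n1] _] := max1.
have sub1 := gs_sub sys F1.
have ltD (M : {set T}) : M \in F -> M != S -> S :\: M != set0.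
  move=> FM nM; rewrite setD_eq0; apply: contra nM => SM.
  by rewrite eqEsubset (gs_sub sys FM).
have nz (M : {set T}) : maxset P M -> M != set0.
  case/maxsetP=> _ mM; apply/eqP=> M0.
  have /setP/(_ x0) : [set x0] = M by apply: mM (ex _ x0S) _;
    rewrite M0 sub0set.
  by rewrite M0 !inE eqxx.
have splitI (U : {set T}) : U \subset S -> U != set0 -> S :\: U != set0 ->
    (forall x y M, x \in U -> y \in S :\: U -> maxset P M -> x \in M ->
      y \in M ->
       False) -> decomposable S.
  move=> US U0 D0 noM; left.
  have [|b ub] := spans_uniform U0 D0 US (subsetDl _ _) (subxx _).
    move=> x y xU yD z Fz xz yz; apply: (big _ _ _ U Fz xz yz) => //.
      by case/setDP: yD.
    by move=> M mM xM yM; apply: noM xU yD mM xM yM.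
  exists U, (S :\: U), b; split=> //; first exact: setU_setD.
  exact: disjoint_setD.
case: (pickP (fun M => maxset P M && overlap M1 M)) => [M2 | no2]; last first.
  apply: (splitI M1) => //; [exact: nz | exact: ltD |].
  move=> x y M xM1 /setDP[_ yM1] mM xM yM.
  by have := no2 M; rewrite mM (maxov _ _ x y).
case/andP=> max2 o12; have /maxsetP[/andP[F2 n2] _] := max2.
have sub2 := gs_sub sys F2.
(* A maximal member meeting [M1 :|: M2] but contained in neither would overlap one of the two, hence
   contain [M1 :&: M2], hence overlap the other as well. *)
have meet3 (M : {set T}) x y : maxset P M -> x \in M -> x \in M1 :|: M2 ->
  y \in M ->
    y \notin M1 -> (exists2 z, z \in M & z \notin M2) -> False.
  move=> mM xM x12 yM yM1 [z zM zM2].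
  have /maxsetP[/andP[FM nM] _] := mM.
  have o3 : overlap M1 M -> overlap M2 M -> False.
    move=> o1M o2M; have := gs_overlap3 sys F1 F2 FM o12 o1M.
    by rewrite o2M.
  have [/set0Pn[h /setIP[h1 h2]] _ _] := and3P o12.
  case/setUP: x12 => xi.
    have o1M := maxov _ _ _ _ max1 mM xi xM yM yM1.
    apply: o3 => //; have /setP/(_ h) := gs_overlap2 sys F1 F2 FM o12 o1M.
    rewrite !inE h1 h2 /= => /esym hM.
    exact: maxov max2 mM h2 hM zM zM2.
  have o2M := maxov _ _ _ _ max2 mM xi xM zM zM2.
  apply: o3 => //; rewrite overlapC in o12.
  have /setP/(_ h) := gs_overlap2 sys F2 F1 FM o12 o2M.
  rewrite !inE h1 h2 /= => /esym hM.
  exact: maxov max1 mM h1 hM yM yM1.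
have [SU | nSU] := boolP (S \subset M1 :|: M2); last first.
  apply: (splitI (M1 :|: M2)); first by rewrite subUset sub1.
  - by have := nz _ max1; apply: contra; rewrite setU_eq0 => /andP[].
  - by rewrite setD_eq0.
  move=> x y M xU /setDP[_]; rewrite inE negb_or => /andP[y1 y2] mM xM yM.
  by apply: (meet3 M x y) => //; exists y.
right; have defS : S = M1 :|: M2 by apply/eqP;
  rewrite eqEsubset SU subUset sub1.
have /and3P[H0 n12 n21] := o12.
have A0 : M1 :\: M2 != set0 by rewrite setD_eq0.
have B0 : M2 :\: M1 != set0 by rewrite setD_eq0.
have [||||b ub] := @spans_uniform (M1 :\: M2) (M2 :\: M1) S A0 B0.
- exact: subset_trans (subsetDl _ _) sub1.
- exact: subset_trans (subsetDl _ _) sub2.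
- exact: subxx.
- move=> x y /setDP[x1 x2] /setDP[y2 y1] z Fz xz yz.
  apply: (big _ _ _ M1 Fz xz yz) => // M mM xM yM.
  by apply: (meet3 M x y) => //; [rewrite inE x1 | exists x].
have E1 : M1 :\: M2 :|: M1 :&: M2 = M1 by rewrite setUC setID.
have E2 : M2 :\: M1 :|: M1 :&: M2 = M2 by rewrite setUC setIC setID.
exists (M1 :\: M2), (M2 :\: M1), (M1 :&: M2), b; split=> //.
- by rewrite -setUA E2 defS; apply/setP=> x; rewrite !inE; case: (x \in M2);
    rewrite ?orbT ?andbT ?orbF.
- by split; rewrite -setI_eq0; apply/eqP/setP=> x; rewrite !inE;
    case: (x \in M1); case: (x \in M2).
- rewrite E1 E2; split; first by apply: overlap_caterpillar => //;
    apply: subsetIl.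
  rewrite setIC; apply: overlap_caterpillar; rewrite 1?overlapC ?subsetIl //.
Qed.

End GallSystem.
End Decomposition.

(** * Brittleness *)

Section Brittle.
Variables (T : finType) (e : rel T).
Hypothesis e_sym : symmetric e.
Hypothesis e_irr : irreflexive e.

(** Distinctness is implied: for symmetric irreflexive [e] the listed adjacencies tell the four
    vertices apart. *)
Definition is_P4 (a b c d : T) : bool :=
  [&& e a b, e b c, e c d, ~~ e a c, ~~ e a d & ~~ e b d].

(** Testing the second position suffices, since reversing a path moves the third one there. *)
Definition nonmidpoint (S : {set T}) (x : T) : Prop :=
  forall a c d, a \in S -> c \in S -> d \in S -> ~~ is_P4 a x c d.

Lemma is_P4_rev a b c d : is_P4 a b c d = is_P4 d c b a.
Proof.
rewrite /is_P4 (e_sym d c) (e_sym c b) (e_sym b a) (e_sym d b) (e_sym d a).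
by rewrite (e_sym c a); do 6![case: (e _ _)].
Qed.

Lemma uniform_sym b (P Q : {set T}) : uniform e b P Q -> uniform e b Q P.
Proof. by move=> u x y xQ yP; rewrite e_sym u. Qed.

Lemma caterpillar_uniform (H N : {set T}) : caterpillar e H N ->
  forall x y y', x \in N -> x \notin H -> y \in H -> y' \in H ->
  e x y = e x y'.
Proof.
move=> cat; suff [] : H \subset N /\ forall x y y', x \in N -> x \notin H ->
  y \in H -> y' \in H -> e x y = e x y' by [].
elim: N / cat => [|N L b _ dLN uLN _ [HN IH]].
  by split=> // x y y' -> .
split; first exact: subset_trans HN (subsetUr _ _).
move=> x y y' /setUP[xL | xN] xH yH y'H; last exact: IH.
by rewrite !(uLN x) ?(subsetP HN).
Qed.

Lemma caterpillar_sub (H N : {set T}) : caterpillar e H N -> H \subset N.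
Proof.
elim: N / => [|N L b _ _ _ _ HN]; first exact: subxx.
exact: subset_trans HN (subsetUr _ _).
Qed.

(* A layer without neighbours further down has only complete layers as
   neighbours outside, and these are pairwise adjacent modules. *)
Lemma caterpillar_simplicial_layer (H N : {set T}) : caterpillar e H N ->
  uniform e true (N :\: H) H \/
  exists L : {set T}, [/\ L != set0, L \subset N :\: H &
    forall a x c d, x \in L -> a \in N -> c \in N ->
      d \in N \/ {in N :\: H &, forall y z, e y d = e z d} ->
      is_P4 a x c d -> [/\ a \in L, c \in L & d \in L]].
Proof.
elim: N / => [|N L b L0 dLN uLN cat IH]; first by left=> x y; rewrite setDv inE.
have HN := caterpillar_sub cat.
have LnN x : x \in L -> x \in N = false by apply: disjointFr.
have LnH x : x \in L -> x \in H = false.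
  by move=> /LnN; apply: contraFF; apply: (subsetP HN).
have NL x y : x \in N -> y \in L -> e x y = b by move=> xN yL;
  rewrite e_sym uLN.
have LD x : x \in L -> x \in (L :|: N) :\: H by move=> xL; rewrite !inE xL LnH.
have ND x : x \in N :\: H -> x \in (L :|: N) :\: H.
  by rewrite !inE => /andP[-> ->]; rewrite orbT.
(* If [L] is anticomplete to [N], the path cannot step from [L] into [N], and a homogeneous [d]
   would see both [x] and [c] or neither. *)
case: b uLN NL => uLN NL; last first.
  right; exists L; split=> //; first by apply/subsetP=> x; apply: LD.
  move=> a x c d xL aU cU dU /and5P[ax xc cd _ /andP[_ xd]].
  have aL : a \in L by case/setUP: aU => // aN; rewrite NL in ax.
  have cL : c \in L by case/setUP: cU => // cN; rewrite uLN in xc.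
  split=> //; case: dU => [/setUP[//|dN] | ud]; first by rewrite uLN in cd.
  by rewrite -(ud c) ?LD // cd in xd.
case: IH => [uH | [L' [L'0 /subsetP sL' IH]]].
  left=> x y /setDP[/setUP[xL | xN] xH] yH; last by rewrite uH // inE xH.
  by rewrite uLN ?(subsetP HN).
right; exists L'; split=> //; first by apply/subsetP=> x /sL' /ND.
move=> a x c d xL' aU cU dU P4.
have /and5P[ax xc cd ac /andP[ad xd]] := P4.
have xN : x \in N by have /setDP[] := sL' _ xL'.
(* Now [L] is complete to [N]. The nonadjacent [a] and [c] lie on the same side, and if both were in
   [L], then [d] would be adjacent to [a]. *)
have dL : d \notin L by apply: contra xd => dL; rewrite NL.
case/setUP: aU => [aL | aN]; case/setUP: cU => [cL | cN].
- case: dU => [/setUP[dL' | dN] | ud]; first by rewrite dL' in dL.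
    by rewrite uLN in ad.
  by rewrite (ud a c) ?LD // cd in ad.
- by rewrite uLN in ac.
- by rewrite NL in ac.
apply: IH P4 => //; case: dU => [/setUP[dL'|dN] | ud];
  [by rewrite dL' in dL|by left|].
by right=> y z /ND yD /ND zD; apply: ud.
Qed.

(** Meant for [A] complete to [B], where [d] may lie on the other side and is then homogeneous to
    the layers and to the core separately. The path avoids an anticomplete layer along its edges and
    a complete one along its non-edges. *)
Lemma caterpillar_simplicial_core (H N : {set T}) : caterpillar e H N ->
  forall a x c d, x \in H -> a \in N -> c \in N ->
    d \in N \/ ({in N :\: H &, forall y z, e y d = e z d} /\
                {in H &, forall y z, e y d = e z d}) ->
    is_P4 a x c d -> [/\ a \in H, c \in H & d \in H].
Proof.
elim: N / => [|N L b L0 dLN uLN cat IH] a x c d xH aU cU dU P4.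
  case: dU => [//|[_ ud]]; have /and5P[_ _ cd _ /andP[_ xd]] := P4.
  by rewrite -(ud c) // cd in xd.
have /and5P[ax xc cd ac /andP[ad xd]] := P4.
have HN := caterpillar_sub cat.
have LnN z : z \in L -> z \in N = false by apply: disjointFr.
have LnH z : z \in L -> z \in H = false.
  by move=> /LnN; apply: contraFF; apply: (subsetP HN).
have NL z y : z \in N -> y \in L -> e z y = b by move=> zN yL;
  rewrite e_sym uLN.
have LD z : z \in L -> z \in (L :|: N) :\: H by move=> zL; rewrite !inE zL LnH.
have ND z : z \in N :\: H -> z \in (L :|: N) :\: H.
  by rewrite !inE => /andP[-> ->]; rewrite orbT.
have xN := subsetP HN _ xH.
have recur : a \in N -> c \in N -> d \notin L ->
  [/\ a \in H, c \in H & d \in H].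
  move=> aN cN dL; apply: IH P4 => //.
  case: dU => [/setUP[dL'|dN] | [ud udH]]; [by rewrite dL' in dL|by left|].
  by right; split=> // y z /ND yD /ND zD; apply: ud.
case: b uLN NL => uLN NL; last first.
  have aN : a \in N by case/setUP: aU => // aL; rewrite uLN in ax.
  have cN : c \in N by case/setUP: cU => // cL; rewrite NL in xc.
  by apply: recur => //; apply: contraL cd => dL; rewrite NL.
have dL : d \notin L by apply: contra xd => dL; rewrite NL.
case/setUP: aU => [aL | aN]; case/setUP: cU => [cL | cN].
- case: dU => [/setUP[dL' | dN] | [ud _]]; first by rewrite dL' in dL.
    by rewrite uLN in ad.
  by rewrite (ud a c) ?LD // cd in ad.
- by rewrite uLN in ac.
- by rewrite NL in ac.
exact: recur.
Qed.

(** The four-vertex path and its complement are both connected: walk from [x] along edges if [b] is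
    false, along non-edges if it is true, never leaving [P]. *)
Lemma uniform_P4 b (P Q : {set T}) a x c d : uniform e b P Q ->
  x \in P -> a \in P :|: Q -> c \in P :|: Q -> d \in P :|: Q ->
  is_P4 a x c d -> [/\ a \in P, c \in P & d \in P].
Proof.
move=> u xP aU cU dU /and5P[ax xc cd ac /andP[ad xd]].
have step y z : y \in P -> z \in P :|: Q -> e y z != b -> z \in P.
  by move=> yP /setUP[//|zQ]; rewrite u ?eqxx.
case: b u step => u step.
  have dP : d \in P by apply: step xP dU _; rewrite (negPf xd).
  have aP : a \in P by apply: step dP aU _; rewrite e_sym (negPf ad).
  by split=> //; apply: step aP cU _; rewrite (negPf ac).
have cP : c \in P by apply: step xP cU _; rewrite xc.
split=> //; first by apply: step xP aU _; rewrite e_sym ax.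
by apply: step cP dU _; rewrite cd.
Qed.

(** Find a nonempty proper subset containing every induced four-vertex path whose second vertex it
    contains; its nonmidpoints remain so in [S]. A part of a split, a layer, or the core serves,
    depending on the decomposition. *)
Lemma exists_nonmidpoint :
  (forall S : {set T}, 1 < #|S| -> decomposable e S) ->
  forall S : {set T}, S != set0 -> exists2 x, x \in S & nonmidpoint S x.
Proof.
move=> dec S; have [n] := ubnP #|S|; elim: n S => // n IH S leS S0.
have [S2 | S1] := ltnP 1 #|S|; last first.
  have /set0Pn[x xS] := S0; exists x => // a c d aS _ _;
    apply/and5P=> -[ax _ _ _ _].
  have /card_le1_eqP/(_ _ _ aS xS) eqx := S1.
  by rewrite eqx e_irr in ax.
have IHs (M : {set T}) : M != set0 -> M \proper S ->
    exists2 x, x \in M & nonmidpoint M x.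
  by move=> M0 /proper_card ltM; apply: IH => //; apply: leq_trans ltM leS.
have lift (M : {set T}) : M != set0 -> M \proper S ->
    (forall a x c d, x \in M -> a \in S -> c \in S -> d \in S ->
       is_P4 a x c d -> [/\ a \in M, c \in M & d \in M]) ->
    exists2 x, x \in S & nonmidpoint S x.
  move=> M0 ltM closed; have [x xM mid] := IHs M M0 ltM.
  exists x; first exact: (subsetP (proper_sub ltM)).
  move=> a c d aS cS dS; apply/negP=> P4.
  by have [aM cM dM] := closed _ _ _ _ xM aS cS dS P4;
    case/negP: (mid a c d aM cM dM).
have split_case : splits e S -> exists2 x, x \in S & nonmidpoint S x.
  case=> P [Q [b [dS P0 Q0 dPQ u]]]; apply: (lift P) => //.
    rewrite properE dS subsetUl; apply/subsetPn; have /set0Pn[q qQ] := Q0.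
    by exists q; rewrite ?inE ?qQ ?orbT // (disjointFl dPQ).
  by move=> a x c d xP; rewrite dS; apply: uniform_P4 u xP.
have [//|[A [B [H [b [dS [A0 B0 H0] [dAB dAH dBH] u [catA catB]]]]]]] :=
  dec S S2.
have u' := uniform_sym u.
case: b u u' => u u'; last first.
  (* This fails only if [C] is complete to [H]; if so on both sides, [A :|: B] against [H] is a
     split. *)
  have one_side (C D : {set T}) : caterpillar e H (C :|: H) ->
      [disjoint C & H] -> [disjoint C & D] ->
      S = C :|: D :|: H -> uniform e false C D -> 
      uniform e true C H \/ exists2 x, x \in S & nonmidpoint S x.
    move=> cat dCH dCD dS' uCD; have := caterpillar_simplicial_layer cat.
    rewrite setU_setD_id // => -[uH | [L [L0 LC closed]]]; first by left.
    right; apply: (lift L) => //.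
      rewrite properE dS'; apply/andP; split.
        by apply: subset_trans LC _; rewrite -setUA subsetUl.
      apply/subsetPn; have /set0Pn[h hH] := H0; exists h;
        first by rewrite inE hH orbT.
      by apply/negP=> /(subsetP LC); rewrite (disjointFl dCH).
    move=> a x c d xL aS cS dU P4.
    have /and5P[ax xc _ _ _] := P4.
    have xC := subsetP LC _ xL.
    have inN z : z \in S -> e x z -> z \in C :|: H.
      rewrite dS' inE => /orP[/setUP[zC|zD]|zH] xz;
        rewrite inE ?zC ?zH ?orbT //.
      by rewrite uCD in xz.
    have aN : a \in C :|: H by apply: inN; rewrite // e_sym.
    apply: closed xL aN (inN _ cS xc) _ P4.
    move: dU; rewrite dS' !inE => /orP[/orP[dC|dD]|dH].
    - by left; rewrite dC.
    - by right=> y z yC zC; rewrite !uCD.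
    - by left; rewrite dH orbT.
  have [uA | //] := one_side A B catA dAH dAB dS u.
  have [||uB | //] := one_side B A catB dBH _ _ u';
    first by rewrite disjoint_sym.
    by rewrite (setUC B).
  apply: split_case; exists (A :|: B), H, true; split=> //.
  - by rewrite setU_eq0 negb_and A0.
  - by rewrite -setI_eq0 setIUl setU_eq0 !setI_eq0 dAH.
  by move=> x y /setUP[xA|xB] yH; [apply: uA | apply: uB].
apply: (lift H) => //.
  rewrite properE dS subsetUr; apply/subsetPn; have /set0Pn[a aA] := A0.
  by exists a; rewrite ?inE ?aA // (disjointFr dAH).
move=> a x c d xH aS cS dU P4.
(* Being nonadjacent, [a] and [c] cannot be divided between [A] and [B], so one side together with
   [H] contains both. *)
have side (C D : {set T}) : caterpillar e H (C :|: H) ->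
     caterpillar e H (D :|: H) -> [disjoint C & H] -> [disjoint D & H] ->
      S = C :|: D :|: H -> uniform e true C D -> a \in C :|: H ->
        c \in C :|: H ->
    [/\ a \in H, c \in H & d \in H].
  move=> catC catD dCH dDH dS' uCD aC cC.
  apply: (caterpillar_simplicial_core catC xH aC cC _ P4).
  move: dU; rewrite dS' !inE => /orP[/orP[dC|dD]|dH].
  - by left; rewrite dC.
  - right; rewrite setU_setD_id //; split=> y z yC zC; first by rewrite !uCD.
    rewrite !(e_sym _ d); apply: (caterpillar_uniform catD) => //.
      by rewrite inE dD.
    by rewrite (disjointFr dDH).
  - by left; rewrite dH orbT.
have dS' : S = B :|: A :|: H by rewrite (setUC B).
have /and5P[_ _ _ ac _] := P4.
move: (aS) (cS); rewrite dS !inE.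
case/orP=> [/orP[aA | aB] | aH]; case/orP=> [/orP[cA | cB] | cH].
- by apply: (side A B); rewrite ?inE ?aA ?cA.
- by rewrite u in ac.
- by apply: (side A B); rewrite ?inE ?aA ?cH ?orbT.
- by rewrite u' in ac.
- by apply: (side B A); rewrite ?inE ?aB ?cB.
- by apply: (side B A); rewrite ?inE ?aB ?cH ?orbT.
- by apply: (side A B); rewrite ?inE ?cA ?aH ?orbT.
- by apply: (side B A); rewrite ?inE ?cB ?aH ?orbT.
- by apply: (side A B); rewrite ?inE ?aH ?cH ?orbT.
Qed.

Lemma nonmidpoint_brittle :
  (forall S : {set T}, S != set0 -> exists2 x, x \in S & nonmidpoint S x) ->
  brittle e.
Proof.
move=> nm S S0; have [x xS mid] := nm S S0; exists (exist _ x xS); left.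
case=> f [[inj fE] [i [hi fi]]].
have P4 : is_P4 (val (f (inord 0))) (val (f (inord 1))) (val (f (inord 2)))
                (val (f (inord 3))).
  have fE' j k : e (val (f j)) (val (f k)) = path_graph j k by rewrite fE.
  by rewrite /is_P4 !fE' /path_graph /= !inordK.
have vf j : val (f j) \in S by apply: valP.
case: hi => hi.
  have di : i = inord 1 by apply: val_inj; rewrite /= inordK.
  rewrite -di fi /= in P4; by case/negP: (mid _ _ _ (vf (inord 0)) (vf (inord
    2)) (vf (inord 3))).
have di : i = inord 2 by apply: val_inj; rewrite /= inordK.
rewrite -di fi is_P4_rev /= in P4;
  by case/negP: (mid _ _ _ (vf (inord 3)) (vf (inord 1)) (vf (inord 0))).
Qed.

End Brittle.

(** * Strong stable sets *)

(** The non-edges form the path [a], [b], [c], [d], [f]. Injectivity follows because distinct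
    vertices of the house have distinct neighbourhoods. *)
Lemma contains_house (T : finType) (e : rel T) (a b c d f : T) :
  symmetric e -> irreflexive e ->
  [/\ ~~ e a b, ~~ e b c, ~~ e c d & ~~ e d f] ->
  [/\ e a c, e a d & e a f] -> [/\ e b d, e b f & e c f] ->
  contains_induced house e.
Proof.
move=> e_sym e_irr [/negbTE n1 /negbTE n2 /negbTE n3 /negbTE n4] [p1 p2 p3] [p4
  p5 p6].
pose s := [:: a; b; c; d; f]; exists (fun i : 'I_5 => nth a s i).
have fE (i j : 'I_5) : house i j = e (nth a s i) (nth a s j).
  case: i => -[|[|[|[|[|//]]]]] hi; case: j => -[|[|[|[|[|//]]]]] hj;
  rewrite /house /complement /path_graph /= -?val_eqE /=;
  rewrite ?e_irr ?n1 ?n2 ?n3 ?n4 ?p1 ?p2 ?p3 ?p4 ?p5 ?p6 //;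
  by rewrite e_sym ?n1 ?n2 ?n3 ?n4 ?p1 ?p2 ?p3 ?p4 ?p5 ?p6.
split=> // i j eqij.
have twin k : house i k = house j k by rewrite !fE eqij.
have: all (fun k => house i k == house j k) [:: inord 0; inord 1; inord 2;
  inord 3; inord 4].
  by apply/allP=> k _; rewrite twin.
apply: contraTeq => neq; move: neq.
rewrite /= /house /complement /path_graph /= -!val_eqE /= !inordK // => neq.
case: i {eqij twin} neq => -[|[|[|[|[|//]]]]] hi;
  case: j => -[|[|[|[|[|//]]]]] hj //.
Qed.

Section StrongStableSets.
Variables (T : finType) (e : rel T).
Hypothesis e_sym : symmetric e.
Hypothesis e_irr : irreflexive e.

(* Equivalent to [I] meeting every maximal clique of [S], but quantifying over
   all cliques makes it stable under joins and disjoint unions. *)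
Record strong_stable (S I : {set T}) : Prop := StrongStable {
  ss_sub : I \subset S;
  ss_stable : {in I &, forall x y, ~~ e x y};
  ss_hits : forall K : {set T}, K \subset S -> clique e K ->
    exists2 x, x \in I & {in K, forall y, (y == x) || e x y} }.

Definition strongly_coverable (S : {set T}) : Prop :=
  forall v, v \in S -> exists2 I, strong_stable S I & v \in I.

Lemma cliqueP (K : {set T}) :
  reflect {in K &, forall x y, x != y -> e x y} (clique e K).
Proof.
apply: (iffP forall_inP) => cK x.
  by move=> y xK yK; have /forall_inP/(_ y yK)/implyP := cK x xK.
by move=> xK; apply/forall_inP=> y yK; apply/implyP; apply: cK.
Qed.

Lemma clique_sub (K K' : {set T}) : K' \subset K -> clique e K -> clique e K'.
Proof.
move=> /subsetP sub /cliqueP cK; apply/cliqueP=> x y xK yK.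
by apply: cK; apply: sub.
Qed.

Lemma clique_uniform_false (P Q K : {set T}) :
  uniform e false P Q -> [disjoint P & Q] -> clique e K ->
  K :&: P != set0 -> K :&: Q = set0.
Proof.
move=> u dPQ /cliqueP cK /set0Pn[x /setIP[xK xP]]; apply/setP=> y.
rewrite !inE; apply/negP=> /andP[yK yQ]; have := cK x y xK yK.
rewrite u // => neq; have: x != y by apply: contraTneq xP => ->;
  rewrite (disjointFl dPQ).
by move/neq.
Qed.

Lemma strong_stable_join (P Q I : {set T}) :
  uniform e true P Q -> strong_stable P I -> strong_stable (P :|: Q) I.
Proof.
move=> u [IP stI hI]; split=> //; first exact: subset_trans IP (subsetUl _ _).
move=> K KS cK; have [||x xI hx] := hI (K :&: P); first exact: subsetIr.
  exact: clique_sub (subsetIl _ _) cK.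
exists x => // y yK; have /setUP[yP|yQ] := subsetP KS _ yK.
  by apply: hx; rewrite inE yK.
by rewrite u ?orbT // (subsetP IP).
Qed.

Lemma strong_stable_union (P Q I J : {set T}) :
  uniform e false P Q -> [disjoint P & Q] ->
  strong_stable P I -> strong_stable Q J -> strong_stable (P :|: Q) (I :|: J).
Proof.
move=> u dPQ [IP stI hI] [JQ stJ hJ]; split; first exact: setUSS.
  move=> x y /setUP[xI|xJ] /setUP[yI|yJ]; [exact: stI | | | exact: stJ].
    by rewrite u ?(subsetP IP) ?(subsetP JQ).
  by rewrite e_sym u ?(subsetP IP) ?(subsetP JQ).
move=> K KS cK; have [KP0 | KP] := eqVneq (K :&: P) set0.
  have [|x xJ hx] := hJ K _ cK; last by exists x; rewrite // inE xJ orbT.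
  apply/subsetP=> x xK; have /setUP[xP|//] := subsetP KS _ xK.
  by move/setP/(_ x): KP0; rewrite !inE xK xP.
have KQ0 := clique_uniform_false u dPQ cK KP.
have [|x xI hx] := hI K _ cK; last by exists x; rewrite // inE xI.
apply/subsetP=> x xK; have /setUP[//|xQ] := subsetP KS _ xK.
by move/setP/(_ x): KQ0; rewrite !inE xK xQ.
Qed.

(** * Gluing strong stable sets along a decomposition *)

Section Induction.
Variable S : {set T}.
Hypothesis cover_proper : forall M : {set T}, M \proper S ->
  strongly_coverable M.

Lemma strong_stable_proper (M : {set T}) : M != set0 -> M \proper S ->
  exists I, strong_stable M I.
Proof.
by move=> /set0Pn[x xM] /cover_proper/(_ x xM)[I ssI _]; exists I.
Qed.

Lemma splits_strongly_coverable : splits e S -> strongly_coverable S.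
Proof.
case=> P [Q [b [dS P0 Q0 dPQ u]]].
have [PS QS] : P \proper S /\ Q \proper S.
  have [/set0Pn[p pP] /set0Pn[q qQ]] := (P0, Q0).
  rewrite dS; split; rewrite properE ?subsetUl ?subsetUr; apply/subsetPn.
    by exists q; rewrite ?inE ?qQ ?orbT // (disjointFl dPQ).
  by exists p; rewrite ?inE ?pP // (disjointFr dPQ).
have dQP : [disjoint Q & P] by rewrite disjoint_sym.
have [I ssI] := strong_stable_proper P0 PS.
have [J ssJ] := strong_stable_proper Q0 QS.
have u' := uniform_sym e_sym u.
move=> v; rewrite {1}dS => /setUP[vP | vQ].
  have [I' ssI' vI'] := cover_proper PS vP; rewrite dS.
  case: b u u' => u u'; first by exists I' => //; apply: strong_stable_join.
  by exists (I' :|: J); [apply: strong_stable_union | rewrite inE vI'].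
have [I' ssI' vI'] := cover_proper QS vQ; rewrite dS setUC.
case: b u u' => u u'; first by exists I' => //; apply: strong_stable_join.
by exists (I' :|: I); [apply: strong_stable_union | rewrite inE vI'].
Qed.

(** Complete layers leave the set unchanged; anticomplete layers contribute a strong stable set of
    their own. *)
Lemma caterpillar_extend (H N I : {set T}) : caterpillar e H N -> N \proper S ->
  strong_stable H I -> exists2 J, strong_stable N J & J :&: H = I.
Proof.
move=> cat; elim: N / cat => [|N L b L0 dLN u cat IH] NS ssI.
  by exists I => //; apply/setIidPl/(ss_sub ssI).
have [|J ssJ JH] := IH _ ssI; first exact: sub_proper_trans (subsetUr _ _) NS.
have LS := sub_proper_trans (subsetUl L N) NS.
case: b u => u.
  by exists J => //; rewrite setUC; apply: strong_stable_join => //;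
    apply: uniform_sym.
have [K ssK] := strong_stable_proper L0 LS.
exists (K :|: J); first exact: strong_stable_union.
rewrite setIUl JH; suff ->: K :&: H = set0 by rewrite set0U.
apply/eqP; rewrite setI_eq0; apply: disjointWl (ss_sub ssK) _.
exact: disjointWr (caterpillar_sub cat) dLN.
Qed.

(** The trace on the core is recorded for gluing with the other side. It is empty if [v] lies in a
    complete layer and strong stable in [H] otherwise. *)
Lemma caterpillar_cover (H N : {set T}) : H != set0 -> caterpillar e H N ->
  N \proper S -> forall v, v \in N ->
  exists J, [/\ strong_stable N J, v \in J &
    J :&: H = set0 \/ strong_stable H (J :&: H)].
Proof.
move=> H0 cat; elim: N / cat => [|N L b L0 dLN u cat IH] NS v.
  move=> vH; have [I ssI vI] := cover_proper NS vH; exists I; split=> //.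
  by right; rewrite (setIidPl (ss_sub ssI)).
have NS' := sub_proper_trans (subsetUr L N) NS.
have LS := sub_proper_trans (subsetUl L N) NS.
have HN := caterpillar_sub cat.
have LH0 K : strong_stable L K -> K :&: H = set0.
  move=> ssK; apply/eqP; rewrite setI_eq0; apply: disjointWl (ss_sub ssK) _.
  exact: disjointWr HN dLN.
have u' := uniform_sym e_sym u.
case/setUP=> [vL | vN].
  have [I ssI vI] := cover_proper LS vL.
  case: b u u' => u u'.
    by exists I; split=> //; [apply: strong_stable_join | left; apply: LH0].
  have [I0 ssI0] := strong_stable_proper H0 (sub_proper_trans HN NS').
  have [J ssJ JH] := caterpillar_extend cat NS' ssI0.
  exists (I :|: J); split; [exact: strong_stable_union | by rewrite inE vI |].
  by right; rewrite setIUl LH0 // set0U JH.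
have [J [ssJ vJ tr]] := IH NS' v vN.
case: b u u' => u u'.
  by exists J; split=> //; rewrite setUC; apply: strong_stable_join.
have [I ssI] := strong_stable_proper L0 LS.
exists (I :|: J); split; [exact: strong_stable_union | by rewrite inE vJ orbT
  |].
by rewrite setIUl LH0 // set0U.
Qed.

Lemma caterpillar_top (H N : {set T}) : caterpillar e H N -> N = H \/
  exists L N' b, [/\ N = L :|: N', L != set0, [disjoint L & N'],
    uniform e b L N' & caterpillar e H N'].
Proof.
by case=> [|N' L b L0 dLN u cat]; [left | right; exists L, N', b].
Qed.

(** An outermost layer attached in the same way as [A] to [B] is homogeneous to the whole rest of
    [S] and splits it off. *)
Lemma top_layer (A B H : {set T}) (b : bool) :
  S = A :|: B :|: H -> A != set0 -> H != set0 ->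
  [disjoint A & B] -> [disjoint A & H] -> uniform e b A B ->
  caterpillar e H (A :|: H) ->
  splits e S \/ exists L N, [/\ A :|: H = L :|: N, L != set0,
    [disjoint L & N], uniform e (~~ b) L N & caterpillar e H N].
Proof.
move=> dS A0 H0 dAB dAH u cat;
  have [AH | [L [N [c [AH L0 dLN uLN cN]]]]] := caterpillar_top cat.
  by have := setU_setD_id dAH; rewrite AH setDv => eqA; rewrite -eqA eqxx in A0.
have [ebc | nbc] := eqVneq c b; last first.
  by right; exists L, N; split=> //; case: (b) (c) nbc uLN => -[].
left; rewrite {c}ebc in uLN; have HN := caterpillar_sub cN.
have LA : L \subset A.
  apply/subsetP=> x xL; have: x \in A :|: H by rewrite AH inE xL.
  case/setUP=> // /(subsetP HN); by rewrite (disjointFr dLN).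
exists L, (N :|: B), b; split=> //.
- by rewrite setUA -AH dS setUAC.
- by rewrite setU_eq0 negb_and; apply/orP; left;
    apply: contraNN H0 => /eqP N0; rewrite -subset0 -N0.
- by rewrite -setI_eq0 setIUr setU_eq0 !setI_eq0 dLN (disjointWl LA).
by move=> x y xL /setUP[yN|yB]; [apply: uLN | apply: u => //;
  apply: (subsetP LA)].
Qed.

(** Strong stable sets of [A :|: H] and [B :|: H] with the same trace on [H] can be united, because
    no clique meets both [A] and [B]. *)
Lemma disjoint_union_cover (A B H : {set T}) :
  S = A :|: B :|: H -> [/\ A != set0, B != set0 & H != set0] ->
  [/\ [disjoint A & B], [disjoint A & H] & [disjoint B & H]] ->
  uniform e false A B ->
  caterpillar e H (A :|: H) -> caterpillar e H (B :|: H) ->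
  forall v, v \in A :|: H -> exists2 I, strong_stable S I & v \in I.
Proof.
move=> dS [A0 B0 H0] [dAB dAH dBH] u catA catB v vAH.
have u' := uniform_sym e_sym u.
have dS' : S = B :|: A :|: H by rewrite (setUC B).
have dBA : [disjoint B & A] by rewrite disjoint_sym.
have [sp | [L [N [BH L0 dLN uLN cN]]]] := top_layer dS' B0 H0 dBA dBH u' catB.
  by apply: splits_strongly_coverable sp _ _; rewrite dS; move: vAH;
    rewrite !inE => /orP[]->; rewrite ?orbT.
have AHS : A :|: H \proper S.
  rewrite properE dS setUAC subsetUl; have /set0Pn[y yB] := B0.
  apply/subsetPn; exists y; first by rewrite inE yB orbT.
  by rewrite inE (disjointFr dBA) // (disjointFr dBH).
have BHS : B :|: H \proper S.
  rewrite properE dS -setUA subsetUr; have /set0Pn[y yA] := A0.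
  apply/subsetPn; exists y; first by rewrite inE yA.
  by rewrite inE (disjointFr dAB) // (disjointFr dAH).
have glue I J : strong_stable (A :|: H) I -> strong_stable (B :|: H) J ->
    I :&: H = J :&: H -> strong_stable S (I :|: J).
  move=> [Isub stI hI] [Jsub stJ hJ] tr; split.
  - by rewrite dS setUUl setUSS.
  - have cross x y : x \in I -> y \in J -> ~~ e x y.
      move=> xI yJ; have /setUP[xA|xH] := subsetP Isub _ xI; last first.
        by apply: stJ => //; have: x \in I :&: H;
          [rewrite inE xI | rewrite tr => /setIP[]].
      have /setUP[yB|yH] := subsetP Jsub _ yJ; first by rewrite u.
      by apply: stI => //; have: y \in J :&: H;
        [rewrite inE yJ | rewrite -tr => /setIP[]].
    move=> x y /setUP[xI|xJ] /setUP[yI|yJ];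
      [exact: stI | exact: cross | | exact: stJ].
    by rewrite e_sym; apply: cross.
  move=> K KS cK.
  have inS x : x \in K -> [|| x \in A, x \in B | x \in H].
    by move/(subsetP KS); rewrite dS !inE orbA.
  have [KA0 | KA] := eqVneq (K :&: A) set0.
    have [|x xJ hx] := hJ K _ cK; last by exists x; rewrite // inE xJ orbT.
    apply/subsetP=> x xK; have := inS x xK; rewrite inE.
    by have /setP/(_ x) := KA0; rewrite !inE xK /= => ->.
  have KB0 := clique_uniform_false u dAB cK KA.
  have [|x xI hx] := hI K _ cK; last by exists x; rewrite // inE xI.
  apply/subsetP=> x xK; have := inS x xK; rewrite inE.
  by have /setP/(_ x) := KB0; rewrite !inE xK /= => ->.
have [J [ssJ vJ tr]] := caterpillar_cover H0 catA AHS vAH.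
suff [J' ssJ' tr'] : exists2 J',
  strong_stable (B :|: H) J' & J' :&: H = J :&: H.
  by exists (J :|: J'); [apply: glue | rewrite inE vJ].
(* An empty trace is matched inside [L], the outermost layer of [B :|: H], which is complete to
   everything below it. *)
case: tr => [J0 | ssH]; last exact: caterpillar_extend catB BHS ssH.
have LBH : L \proper S by apply: sub_proper_trans BHS; rewrite BH subsetUl.
have [I ssI] := strong_stable_proper L0 LBH.
exists I; first by rewrite BH; apply: strong_stable_join.
rewrite J0; apply/eqP; rewrite setI_eq0; apply: disjointWl (ss_sub ssI) _.
exact: disjointWr (caterpillar_sub cN) dLN.
Qed.

Lemma caterpillar_complete_layer (H N : {set T}) : caterpillar e H N ->
  uniform e false (N :\: H) H \/
  exists2 x, x \in N :\: H & {in H, forall h, e x h}.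
Proof.
elim: N / => [|N L b L0 dLN u cat IH]; first by left=> x y; rewrite setDv inE.
have HN := caterpillar_sub cat.
case: b u => u.
  right; have /set0Pn[x xL] := L0; exists x.
    rewrite !inE xL andbT; apply/negP=> /(subsetP HN).
    by rewrite (disjointFr dLN).
  by move=> h hH; rewrite u // (subsetP HN).
case: IH => [uH | [x /setDP[xN xH] hx]]; last first.
  by right; exists x => //; rewrite !inE xH xN orbT.
left=> x y /setDP[/setUP[xL | xN] xH] yH; last by rewrite uH // inE xH.
by rewrite u ?(subsetP HN).
Qed.

(** In [join_cover] the cliques to hit lie in [A :|: B] or in [B :|: H], so a single set has to work
    with and without the core. *)
Lemma caterpillar_double_cover (H N : {set T}) : H != set0 ->
  caterpillar e H N -> N \proper S ->
  uniform e false (N :\: H) H \/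
  N :\: H != set0 /\ forall v, v \in N :\: H ->
    exists J, [/\ strong_stable N J,
      strong_stable (N :\: H) (J :\: H) & v \in J].
Proof.
move=> H0; elim: N / => [|N L b L0 dLN u cat IH] NS.
  by left=> x y; rewrite setDv inE.
have NS' := sub_proper_trans (subsetUr L N) NS.
have LS := sub_proper_trans (subsetUl L N) NS.
have HN := caterpillar_sub cat.
have dLH : [disjoint L & H] := disjointWr HN dLN.
have LD (K : {set T}) : K \subset L -> K :\: H = K.
  by move=> KL; apply/setDidPl; apply: disjointWl KL dLH.
have UD : (L :|: N) :\: H = L :|: (N :\: H) by rewrite setDUl LD.
have uD : uniform e b L (N :\: H) by move=> x y xL /setDP[yN _]; apply: u.
have dLD : [disjoint L & N :\: H] by apply: disjointWr dLN; apply: subsetDl.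
have nz : (L :|: N) :\: H != set0 by rewrite UD setU_eq0 negb_and L0.
have [I0 ssI0] := strong_stable_proper L0 LS.
have u' := uniform_sym e_sym u; have uD' := uniform_sym e_sym uD.
case: b u u' uD uD' => u u' uD uD'.
  right; split=> // v; rewrite UD => /setUP[vL | vD].
    have [I ssI vI] := cover_proper LS vL; exists I; split=> //.
      exact: strong_stable_join.
    by rewrite (LD I) ?(ss_sub ssI) //; apply: strong_stable_join.
  have [J [ssJ ssJD vJ]] : exists J, [/\ strong_stable N J,
      strong_stable (N :\: H) (J :\: H) & v \in J].
    (* If all lower layers are anticomplete to the core, sets for [N :\: H] and for [H] are chosen
       independently. *)
    have [uH | [_ cov]] := IH NS'; last exact: cov.
    have DS : N :\: H \proper S by apply: sub_proper_trans NS'; apply: subsetDl.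
    have [I ssI vI] := cover_proper DS vD.
    have [K ssK] := strong_stable_proper H0 (sub_proper_trans HN NS').
    exists (I :|: K); split; last by rewrite inE vI.
      rewrite (setU_setD HN) setUC; apply: strong_stable_union => //.
      by rewrite disjoint_sym disjoint_setD.
    have KH0 : K :\: H = set0 by apply/eqP; rewrite setD_eq0; exact: ss_sub ssK.
    rewrite setDUl KH0 setU0.
    suff -> : I :\: H = I by [].
    apply/setDidPl; apply: disjointWl (ss_sub ssI) _.
    by rewrite disjoint_sym disjoint_setD.
  by exists J; split=> //; rewrite (setUC L); apply: strong_stable_join.
have [uH | [D0 cov]] := IH NS'.
  left; rewrite UD => x y /setUP[xL|xD] yH; last exact: uH.
  by rewrite u ?(subsetP HN).
right; split=> // v; rewrite UD => /setUP[vL | vD].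
  have [I ssI vI] := cover_proper LS vL.
  have /set0Pn[w wD] := D0; have [J [ssJ ssJD _]] := cov w wD.
  exists (I :|: J); split; [exact: strong_stable_union | | by rewrite inE vI].
  by rewrite setDUl (LD I) ?(ss_sub ssI) //; apply: strong_stable_union.
have [J [ssJ ssJD vJ]] := cov v vD.
exists (I0 :|: J); split; [exact: strong_stable_union | | by rewrite inE vJ
  orbT].
by rewrite setDUl (LD I0) ?(ss_sub ssI0) //; apply: strong_stable_union.
Qed.

(** A clique lies in [A :|: B] or in [B :|: H]. Vertices of [A] and [H] are covered by uniting
    strong stable sets of [A] and of [H], those of [B] by [caterpillar_double_cover]. *)
Lemma join_cover (A B H : {set T}) :
  S = A :|: B :|: H -> [/\ A != set0, B != set0 & H != set0] ->
  [/\ [disjoint A & B], [disjoint A & H] & [disjoint B & H]] ->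
  uniform e true A B -> uniform e false A H -> caterpillar e H (B :|: H) ->
  strongly_coverable S.
Proof.
move=> dS [A0 B0 H0] [dAB dAH dBH] u uH catB v vS.
have BHS : B :|: H \proper S.
  rewrite properE dS -setUA subsetUr; have /set0Pn[y yA] := A0.
  apply/subsetPn; exists y; first by rewrite inE yA.
  by rewrite inE (disjointFr dAB) // (disjointFr dAH).
have inS x : x \in S -> [|| x \in A, x \in B | x \in H] by rewrite dS !inE orbA.
have := caterpillar_double_cover H0 catB BHS.
rewrite setU_setD_id // => -[uBH | [_ cov]].
  apply: splits_strongly_coverable vS; exists (A :|: B), H, false; split=> //.
  - by rewrite setU_eq0 negb_and A0.
  - by rewrite -setI_eq0 setIUl setU_eq0 !setI_eq0 dAH.
  by move=> x y /setUP[xA|xB] yH; [apply: uH | apply: uBH].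
have cases (K : {set T}) : K \subset S -> clique e K ->
    K \subset A :|: B \/ K \subset B :|: H /\ K :&: H != set0.
  move=> KS cK; have [KH0 | KH] := eqVneq (K :&: H) set0.
    left; apply/subsetP=> x xK; have := inS x (subsetP KS _ xK); rewrite inE.
    by have /setP/(_ x) := KH0; rewrite !inE xK /= => ->; rewrite orbF.
  have dHA : [disjoint H & A] by rewrite disjoint_sym.
  have KA0 := clique_uniform_false (uniform_sym e_sym uH) dHA cK KH.
  right; split=> //; apply/subsetP=> x xK; have := inS x (subsetP KS _ xK).
  by rewrite inE; have /setP/(_ x) := KA0; rewrite !inE xK /= => ->.
have covAH I J : strong_stable A I -> strong_stable H J ->
    strong_stable S (I :|: J).
  move=> ssI ssJ; have ssU := strong_stable_union uH dAH ssI ssJ.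
  split.
  - by apply: subset_trans (ss_sub ssU) _; rewrite dS setUAC subsetUl.
  - exact: ss_stable ssU.
  move=> K KS cK; have [KAB | [KBH /set0Pn[z /setIP[zK zH]]]] := cases K KS cK.
    have [x xI hx] := ss_hits (strong_stable_join u ssI) KAB cK.
    by exists x; rewrite // inE xI.
  have [|x xJ hx] := ss_hits ssJ (subsetIr K H).
    exact: clique_sub (subsetIl _ _) cK.
  exists x; first by rewrite inE xJ orbT.
  have xH := subsetP (ss_sub ssJ) _ xJ.
  (* A vertex of [B] adjacent to [z] in the core is adjacent to the whole core, in particular to
     [x]. *)
  move=> y yK; have /setUP[yB|yH] := subsetP KBH _ yK; last first.
    by apply: hx; rewrite inE yK.
  have yH : y \notin H by rewrite (disjointFr dBH).
  have yBH : y \in B :|: H by rewrite inE yB.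
  rewrite e_sym (caterpillar_uniform catB yBH yH xH zH).
  have /cliqueP-> // := cK; first by rewrite orbT.
  by apply: contraNneq yH => ->.
have propU (M : {set T}) x : M \subset S -> x \in S -> x \notin M ->
  M \proper S.
  by move=> MS xS xM; rewrite properE MS; apply/subsetPn; exists x.
have [/set0Pn[a aA] /set0Pn[h hH]] := (A0, H0).
have AS : A \proper S.
  apply: (propU A h); rewrite ?(disjointFl dAH) ?dS -?setUA ?subsetUl //.
  by rewrite !inE hH !orbT.
have HS : H \proper S.
  apply: (propU H a); rewrite ?(disjointFr dAH) ?dS ?subsetUr //.
  by rewrite !inE aA.
have [I0 ssI0] := strong_stable_proper A0 AS.
have [J0 ssJ0] := strong_stable_proper H0 HS.
case/or3P: (inS v vS) => [vA | vB | vH].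
- have [I ssI vI] := cover_proper AS vA.
  by exists (I :|: J0); [apply: covAH | rewrite inE vI].
- have [J [ssJ ssJB vJ]] := cov v vB; exists J => //; split.
  + exact: subset_trans (ss_sub ssJ) (proper_sub BHS).
  + exact: ss_stable ssJ.
  move=> K KS cK; have [KAB | [KBH _]] := cases K KS cK;
    last exact (ss_hits ssJ KBH cK).
  rewrite setUC in KAB.
  have [x /setDP[xJ _] hx] := ss_hits (strong_stable_join (uniform_sym e_sym u)
    ssJB) KAB cK.
  by exists x.
have [J ssJ vJ] := cover_proper HS vH.
by exists (I0 :|: J); [apply: covAH | rewrite inE vJ orbT].
Qed.

(** In the join case, unless [S] splits, both outermost layers are anticomplete to what lies below.
    If one side has no complete layer, [join_cover] applies; complete layers on both sides yield a
    house. *)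
Lemma decomposable_strongly_coverable :
  ~ contains_induced house e -> decomposable e S -> strongly_coverable S.
Proof.
move=> nohouse [|[A [B [H [b [dS n0 disj u [catA catB]]]]]]].
  exact: splits_strongly_coverable.
have [[A0 B0 H0] [dAB dAH dBH]] := (n0, disj).
have u' := uniform_sym e_sym u.
have dBA : [disjoint B & A] by rewrite disjoint_sym.
have dS' : S = B :|: A :|: H by rewrite (setUC B).
case: b u u' => u u'; last first.
  move=> v; rewrite {1}dS inE => /orP[/setUP[vA|vB]|vH].
  - by apply: (disjoint_union_cover dS) => //; rewrite inE vA.
  - by apply: (disjoint_union_cover dS') => //; rewrite inE vB.
  - by apply: (disjoint_union_cover dS) => //; rewrite inE vH orbT.
have [sp|[L [N [AH L0 dLN uLN cN]]]] := top_layer dS A0 H0 dAB dAH u catA.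
  exact: splits_strongly_coverable.
have [sp|[M [P [BH M0 dMP uMP cP]]]] := top_layer dS' B0 H0 dBA dBH u' catB.
  exact: splits_strongly_coverable.
have := caterpillar_complete_layer catA;
  rewrite setU_setD_id // => -[uA | [x xA xH]].
  exact: join_cover uA catB.
have := caterpillar_complete_layer catB;
  rewrite setU_setD_id // => -[uB | [y yB yH]].
  exact: join_cover uB catA.
(* The witness [w] comes from the outermost layer; [z] lies below that layer because it sees the
   core. *)
have corner (C L' N' : {set T}) z : [disjoint C & H] -> C :|: H = L' :|: N' ->
    L' != set0 -> [disjoint L' & N'] -> uniform e false L' N' ->
    caterpillar e H N' -> z \in C -> {in H, forall h, e z h} ->
    exists2 w, w \in C & ~~ e w z /\ {in H, forall h, ~~ e w h}.
  move=> dCH eqC /set0Pn[w wL] dL uL cat zC zH; have HN := caterpillar_sub cat.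
  have /set0Pn[h hH] := H0.
  exists w.
    have: w \in C :|: H by rewrite eqC inE wL.
    by case/setUP=> // /(subsetP HN); rewrite (disjointFr dL).
  split; last by move=> k kH; rewrite uL // (subsetP HN).
  have: z \in C :|: H by rewrite inE zC.
  rewrite eqC => /setUP[zL | zN]; last by rewrite uL.
  by have := zH h hH; rewrite uL // (subsetP HN).
have [x1 x1A [x1x x1H]] := corner A L N x dAH AH L0 dLN uLN cN xA xH.
have [y1 y1B [y1y y1H]] := corner B M P y dBH BH M0 dMP uMP cP yB yH.
have /set0Pn[h hH] := H0; case: nohouse.
apply: (@contains_house _ _ x x1 h y1 y) => //.
- split=> //; first by rewrite e_sym.
    exact: x1H.
  by rewrite e_sym; apply: y1H.
- by split; [apply: xH | rewrite u | rewrite u].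
- by split; [rewrite u | rewrite u | rewrite e_sym yH].
Qed.

End Induction.

Lemma strong_stable_induced (S I : {set T}) (v : {x : T | x \in S}) :
  strong_stable S I -> val v \in I -> in_strong_stable_set (@induced T e S) v.
Proof.
move=> [IS stI hI] vI; exists [set x | val x \in I]; split.
- apply/forall_inP=> x; rewrite inE => xI; apply/forall_inP=> y;
    rewrite inE => yI.
  exact: stI.
- by rewrite inE.
move=> K /maxsetP[cK maxK].
have cK' x y : x \in K -> y \in K -> x != y -> e (val x) (val y).
  by move=> xK yK; have /forall_inP/(_ x xK)/forall_inP/(_ y yK)/implyP := cK.
have [||x xI hx] := hI [set val x | x in K].
- by apply/subsetP=> _ /imsetP[x _ ->]; apply: valP.
- apply/cliqueP=> _ _ /imsetP[x xK ->] /imsetP[y yK ->].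
  by rewrite val_eqE; apply: cK'.
pose x' : {x : T | x \in S} := exist _ x (subsetP IS _ xI).
have hx' y : y \in K -> y != x' -> e x (val y).
  by move=> yK; rewrite -val_eqE => /negPf ne; have := hx _ (imset_f val yK);
    rewrite ne.
(* Adding [x'] keeps [K] a clique, so by maximality it is already in [K]. *)
apply/set0Pn; exists x'; rewrite inE inE xI /= -(maxK (x' |: K)) ?setU11
  ?subsetUr //.
apply/forall_inP=> y /setU1P[-> | yK]; apply/forall_inP=> z /setU1P[-> | zK];
  apply/implyP.
- by rewrite eqxx.
- by rewrite eq_sym; apply: hx'.
- by move=> ne; rewrite /induced /= e_sym; apply: hx'.
- exact: cK'.
Qed.

Lemma decomposable_very_strongly_perfect :
  ~ contains_induced house e ->
  (forall S : {set T}, 1 < #|S| -> decomposable e S) -> very_strongly_perfect e.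
Proof.
move=> nohouse dec S v.
suff cov (M : {set T}) : strongly_coverable M.
  have [I ssI vI] := cov S _ (valP v); exact: strong_stable_induced ssI vI.
have [n] := ubnP #|M|; elim: n M => // n IH M leM.
have [M2 | M1] := ltnP 1 #|M|.
  apply: decomposable_strongly_coverable nohouse (dec _ M2) =>
    M' /proper_card ltM.
  by apply: IH; apply: leq_trans ltM leM.
have /card_le1_eqP eqM := M1.
move=> x xM; exists [set x]; last exact: set11.
split; first by rewrite sub1set.
  by move=> y z /set1P-> /set1P->; rewrite e_irr.
move=> K KM _; exists x; first exact: set11.
by move=> y yK; rewrite (eqM y x) ?eqxx //; apply: (subsetP KM).
Qed.

End StrongStableSets.

(** * Odd cycles *)

Section Cycles.
Variables (T : finType) (e : rel T).
Hypothesis e_sym : symmetric e.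
Hypothesis e_irr : irreflexive e.

Lemma chords_rot (c : seq T) n : uniq c -> chords e (rot n c) = chords e c.
Proof.
move=> Uc; apply/setP=> A; apply/imsetP/imsetP => -[p pc ->]; exists p => //.
  by move: pc; rewrite !inE !mem_rot !next_rot.
by move: pc; rewrite !inE !mem_rot !next_rot.
Qed.

Lemma mem_chords (c : seq T) x y : x \in c -> y \in c -> e x y ->
  y != next c x -> x != next c y -> [set x; y] \in chords e c.
Proof.
by move=> xc yc xy ny nx; apply/imsetP; exists (x, y);
  rewrite // inE xc yc xy ny nx.
Qed.

(** On a chordless cycle of length at least five every vertex is second on the induced four-vertex
    path that starts at its predecessor. *)
Lemma no_hole (c : seq T) :
  (forall S : {set T}, S != set0 -> exists2 x, x \in S & nonmidpoint e S x) ->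
  ucycle e c -> 4 < size c -> chords e c != set0.
Proof.
move=> nm uc c5; apply/eqP=> no_chord.
have [|x xS mid] := nm [set x in c].
  by case: c c5 {uc no_chord} => // x c _; apply/set0Pn; exists x;
    rewrite !inE eqxx.
have {xS} xc : x \in c by rewrite inE in xS.
have /andP[_ Uc] := uc.
have [i s defc] := rot_to (etrans (mem_prev c x) xc).
have Ec : cycle e (rot i c) by rewrite rot_cycle; case/andP: uc.
have Urc : uniq (rot i c) by rewrite rot_uniq.
have no_chord' : chords e (rot i c) = set0 by rewrite chords_rot.
have nx : next (rot i c) (prev c x) = x by rewrite next_rot // next_prev.
have memc y : y \in rot i c -> y \in [set x in c] by rewrite inE mem_rot.
have nadj y z : y \in rot i c -> z \in rot i c -> z != next (rot i c) y ->
    y != next (rot i c) z -> ~~ e y z.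
  move=> yc zc ny nz; apply/negP=> yz.
  by have := mem_chords yc zc yz ny nz; rewrite no_chord' inE.
have: 4 < size (rot i c) by rewrite size_rot.
move: memc nadj nx Ec Urc; rewrite defc; move: (prev c x) => a.
(* The fifth vertex [f] keeps [d] and [a] from being consecutive. *)
case: s {defc} => [|x' [|b [|d [|f s]]]] //.
set c' := [:: a, x', b, d, f & s] => memc nadj.
have -> : next c' a = x' by rewrite /= eqxx.
move=> eqx; move: memc nadj; rewrite {}/c' {x'}eqx;
  set c' := [:: a, x, b, d, f & s].
move=> memc nadj Ec Urc _.
have /and5P[ax xb bd df _] : [&& e a x, e x b, e b d,
  e d f & path e f (rcons s a)] := Ec.
have /and5P[] := Urc; rewrite !inE !negb_or.
case/and5P=> nax nab nad naf _ /and4P[nxb nxd nxf _] /and3P[nbd nbf _]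
  /andP[ndf _] _.
have na : next c' a = x by rewrite /= eqxx.
have nx : next c' x = b by rewrite /= eq_sym (negbTE nax) eqxx.
have nb : next c' b = d by rewrite /= eq_sym (negbTE nab) eq_sym (negbTE nxb)
  eqxx.
have nd : next c' d = f.
  by rewrite /= eq_sym (negbTE nad) eq_sym (negbTE nxd) eq_sym (negbTE nbd)
    eqxx.
have [ac xc' bc dc] : [/\ a \in c', x \in c', b \in c' & d \in c'].
  by rewrite !inE !eqxx !orbT.
have /negP[] := mid a b d (memc _ ac) (memc _ bc) (memc _ dc).
by rewrite /is_P4 ax xb bd !nadj // ?na ?nx ?nb ?nd // eq_sym.
Qed.

Lemma next_cons_nth (u y : T) (s : seq T) :
  y \in u :: s -> next (u :: s) y = nth u s (index y (u :: s)).
Proof. by rewrite next_nth => ->. Qed.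

Lemma next_cat_prefix (u w : T) (p q q' : seq T) y : y \in u :: p ->
  next (u :: p ++ w :: q) y = next (u :: p ++ w :: q') y.
Proof.
move=> yp.
have nextE r : next (u :: p ++ w :: r) y = nth u (rcons p w) (index y (u :: p)).
  rewrite next_cons_nth -cat_cons; last by rewrite mem_cat yp.
  rewrite index_cat yp -cat_rcons nth_cat ifT // size_rcons.
  by rewrite -(index_mem y) in yp.
by rewrite !nextE.
Qed.

(** The default [u] of [head] is the wrap-around for empty [q]. *)
Lemma next_cat_mid (u w : T) (p q : seq T) :
  w \notin u :: p -> next (u :: p ++ w :: q) w = head u q.
Proof.
move=> wp; rewrite next_cons_nth -cat_cons;
  last by rewrite mem_cat mem_head orbT.
rewrite index_cat (negPf wp) index_head addn0 nth_cat ltnNge leqnSn /=.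
by rewrite subSnn /= nth0.
Qed.

(** A chord of the half is a chord of the whole cycle, hence joins [u] and [w]; but these are
    consecutive in the half. *)
Lemma chord_half (u w : T) (p q : seq T) :
  ucycle e (u :: p ++ w :: q) -> e w u ->
  chords e (u :: p ++ w :: q) \subset [set [set u; w]] ->
  ucycle e (u :: p ++ [:: w]) /\ chords e (u :: p ++ [:: w]) = set0.
Proof.
move=> /andP[Ec Uc] wu sub; set c := u :: p ++ w :: q in Ec Uc sub *.
set c' := u :: p ++ [:: w].
have memc y : y \in c' -> y \in c.
  rewrite /c /c' -!cat_cons !mem_cat mem_seq1 (in_cons w).
  by case/orP=> ->; rewrite ?orbT.
have [Uup disj] : uniq (u :: p) /\ ~~ has (mem (u :: p)) (w :: q).
  by move: Uc; rewrite /c -cat_cons cat_uniq => /and3P[].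
have wup : w \notin u :: p by move: disj; rewrite /= negb_or => /andP[].
split.
  apply/andP; split; last by rewrite /c' -cat_cons cats1 rcons_uniq wup.
  move: Ec; rewrite /c /c' /= cats1 !rcons_path last_rcons wu andbT.
  by rewrite cat_path /= => /andP[/and3P[-> ->]].
have nc'w : next c' w = u by rewrite next_cat_mid.
have ncw : next c w = head u q by rewrite next_cat_mid.
have nwz v : v \in c' -> v != next c' w -> v != w -> v != next c w.
  rewrite nc'w ncw /c' -cat_cons mem_cat mem_seq1 => /orP[vup | ->] // vu _.
  apply: contraNneq disj => eqv;
    case: q eqv {Ec Uc sub c memc ncw} => [|x q] /= eqv.
    by rewrite eqv eqxx in vu.
  by rewrite -eqv vup orbT.
have nextc y z : y \in c' -> z \in c' -> z != y -> z != next c' y ->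
  z != next c y.
  move=> yc zc zy; have [eyw | nyw] := eqVneq y w.
    by rewrite eyw in zy *; move=> zn; apply: nwz.
  have yup : y \in u :: p.
    by move: yc; rewrite /c' -cat_cons mem_cat mem_seq1 (negPf nyw) orbF.
  by rewrite (@next_cat_prefix _ _ _ [::] q).
apply/eqP/set0Pn=> -[A /imsetP[[y z]]].
rewrite inE.
move=> /and5P[yc zc yz nz ny] _ {A}.
have {}nz : z != next c' y := nz; have {}ny : y != next c' z := ny.
have nyz : y != z by apply: contraTneq yz => ->; rewrite e_irr.
have key : [set y; z] \in chords e c.
  by apply: mem_chords; rewrite ?memc // nextc // eq_sym.
have /(subsetP sub) := key; rewrite inE => /eqP eqs.
have wyz : w \in [set y; z] by rewrite eqs !inE eqxx orbT.
have uyz : u \in [set y; z] by rewrite eqs !inE eqxx.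
have nuw : u != w by apply: contraNneq wup => ->; rewrite inE eqxx.
move: wyz uyz; rewrite !inE => /orP[] /eqP ew /orP[] /eqP eu.
- by rewrite ew eu eqxx in nuw.
- by rewrite -ew -eu nc'w eqxx in nz.
- by rewrite -ew -eu nc'w eqxx in ny.
- by rewrite ew eu eqxx in nuw.
Qed.

(** A unique chord cuts the cycle into two chordless halves, of at most four vertices each by
    [no_hole]. Parity leaves a triangle and a square sharing the chord, which is a house. *)
Lemma house_free_Meyniel :
  (forall S : {set T}, S != set0 -> exists2 x, x \in S & nonmidpoint e S x) ->
  ~ contains_induced house e -> Meyniel e.
Proof.
move=> nm nohouse c uc oddc c5; rewrite ltnNge; apply/negP=> le1.
have /set0Pn[A AC] := no_hole nm uc c5.
have sub : chords e c \subset [set A].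
  by apply/subsetP=> B BC; rewrite inE; apply/eqP; have /card_le1_eqP := le1;
    apply.
have /imsetP[[u w]] := AC; rewrite inE /= => /and5P[uin win uw nw nu] defA.
have [i s defc] := rot_to uin.
have /andP[_ Uc] := uc.
have uc' : ucycle e (u :: s) by rewrite -defc rot_ucycle.
have sz : size (u :: s) = size c by rewrite -defc size_rot.
have sub' : chords e (u :: s) \subset [set [set u; w]].
  by rewrite -defc chords_rot // -defA.
have nuw : u != w by apply: contraTneq uw => ->; rewrite e_irr.
have ws : w \in s.
  by have := win; rewrite -(mem_rot i) defc inE eq_sym (negPf nuw).
have {nw} nw : w != next (u :: s) u by rewrite -defc next_rot.
have {nu} nu : u != next (u :: s) w by rewrite -defc next_rot.
move: uc' sz sub' nw nu; have [p q] := splitPr ws => uc' sz sub' nw nu.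
have /andP[Ec' Uc'] := uc'.
have p0 : 0 < size p.
  by case: (p) nw => //=; rewrite eqxx eqxx.
have q0 : 0 < size q.
  rewrite next_cat_mid in nu; first by case: (q) nu => //=; rewrite eqxx.
  by move: Uc'; rewrite -cat_cons cat_uniq => /and3P[_ /=];
    rewrite negb_or => /andP[].
have wu : e w u by rewrite e_sym.
have small (x y : T) (r t : seq T) : ucycle e (x :: r ++ y :: t) -> e y x ->
    chords e (x :: r ++ y :: t) \subset [set [set x; y]] -> size r <= 2.
  move=> ucr yx subr; have [ucr' chr] := chord_half ucr yx subr.
  rewrite leqNgt; apply/negP=> r3; suff: chords e (x :: r ++ [:: y]) != set0.
    by rewrite chr eqxx.
  by apply: no_hole nm ucr' _; rewrite /= size_cat addn1 !ltnS.
have p2 := small _ _ _ _ uc' wu sub'.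
have rotE : rot (size (u :: p)) (u :: p ++ w :: q) = w :: q ++ u :: p.
  by rewrite -cat_cons rot_size_cat.
have ucq : ucycle e (w :: q ++ u :: p) by rewrite -rotE rot_ucycle.
have subq : chords e (w :: q ++ u :: p) \subset [set [set w; u]].
  by rewrite -rotE chords_rot // (setUC [set w]).
have q2 := small _ _ _ _ ucq uw subq.
(* The triangle is [x], [a], [y] and the square [x], [y], [b], [d]; the non-edges form the path [x],
   [b], [a], [d], [y]. *)
have final (x y a b d : T) : ucycle e [:: x; a; y; b; d] -> e x y ->
    chords e [:: x; a; y; b; d] \subset [set [set x; y]] -> False.
  set c' := [:: x; a; y; b; d] => /andP[Ecc Ucc] xy subc; case: nohouse.
  have /and5P[xa ay yb bd /andP[dx _]] : [&& e x a, e a y, e y b, e b d,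
    e d x & true] := Ecc.
  have /and5P[] := Ucc; rewrite !inE !negb_or.
  case/and4P=> nxa nxy nxb nxd /and3P[nay nab nad] /andP[nyb nyd] nbd _.
  have nx : next c' x = a by rewrite /= eqxx.
  have na : next c' a = y by rewrite /= eq_sym (negPf nxa) eqxx.
  have ny : next c' y = b by rewrite /= eq_sym (negPf nxy) eq_sym (negPf nay)
    eqxx.
  have nb : next c' b = d.
    by rewrite /= eq_sym (negPf nxb) eq_sym (negPf nab) eq_sym (negPf nyb) eqxx.
  have nd : next c' d = x.
    by rewrite /= eq_sym (negPf nxd) eq_sym (negPf nad) eq_sym (negPf nyd)
      eq_sym (negPf nbd) eqxx.
  have nadj k l : k \in c' -> l \in c' -> l != next c' k -> k != next c' l ->
      (k != x) && (k != y) || (l != x) && (l != y) -> ~~ e k l.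
    move=> kc lc nk nl out; apply/negP=> kl.
    have /(subsetP subc) := mem_chords kc lc kl nk nl; rewrite inE => /eqP eqs.
    have: k \in [set x; y] by rewrite -eqs !inE eqxx.
    have: l \in [set x; y] by rewrite -eqs !inE eqxx orbT.
    by rewrite !inE; move: out; rewrite -!negb_or => /orP[] /negPf->.
  have [xc ac yc bc dc] : [/\ x \in c', a \in c', y \in c',
    b \in c' & d \in c'].
    by rewrite !inE !eqxx !orbT.
  have ne := (nxa, nxy, nxb, nxd, nay, nab, nad, nyb, nyd, nbd).
  have flip (k l : T) : k != l -> l != k by rewrite eq_sym.
  have ne' := (flip _ _ nxa, flip _ _ nxy, flip _ _ nxb, flip _ _ nxd,
    flip _ _ nay,
    flip _ _ nab, flip _ _ nad, flip _ _ nyb, flip _ _ nyd, flip _ _ nbd).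
  apply: (@contains_house _ _ x b a d y) => //.
  - by split; apply: nadj; rewrite ?nx ?na ?ny ?nb ?nd ?ne ?ne' ?orbT.
  - by split; rewrite // e_sym.
  - by split; rewrite // e_sym.
move: sz; rewrite /= size_cat /= => sz; move: oddc c5; rewrite -sz.
clear small rotE nu nw Ec' Uc' ws sz; move: uc' sub' ucq subq p0 p2 q0 q2.
(* Each of [p] and [q] has one or two vertices, and by parity not the same number. *)
case: p => [|a [|a' [|a'' p]]] //;
  case: q => [|b [|b' [|b'' q]]] // uc' sub' ucq subq.
  by move=> *; apply: final uc' uw sub'.
by move=> *; apply: final ucq wu subq.
Qed.

End Cycles.

(** * Clusters of galled trees *)

Section Biconnected.
Variables (V : finType) (E : rel V).

Definition within (A : {set V}) : rel V :=
  [rel a b | [&& a \in A, b \in A & underlying E a b]].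

Lemma connected_inP (A : {set V}) :
  reflect {in A &, forall u v, connect (within A) u v} (connected_in E A).
Proof.
apply: (iffP forall_inP) => h u.
  by move=> v uA vA; have /forall_inP := h u uA; apply.
by move=> uA; apply/forall_inP=> v vA; apply: h.
Qed.

Lemma within_connect_sym (A : {set V}) : connect_sym (within A).
Proof.
apply: sym_connect_sym => u v; rewrite /within /= /underlying /= orbC.
by rewrite andbCA.
Qed.

Lemma within_sub (A B : {set V}) : A \subset B ->
  subrel (connect (within A)) (connect (within B)).
Proof.
move=> /subsetP AB; apply: connect_sub => u v /and3P[uA vA uv].
by apply: connect1; rewrite /within /= !AB.
Qed.

Lemma connected_in_setU (A B : {set V}) x : x \in A -> x \in B ->
  connected_in E A -> connected_in E B -> connected_in E (A :|: B).
Proof.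
move=> xA xB /connected_inP cA /connected_inP cB; apply/connected_inP.
have toX u : u \in A :|: B -> connect (within (A :|: B)) u x.
  case/setUP=> [uA | uB].
    exact: (within_sub (subsetUl A B)) (cA _ _ uA xA).
  exact: (within_sub (subsetUr A B)) (cB _ _ uB xB).
move=> u v /toX ux /toX; rewrite within_connect_sym; exact: connect_trans.
Qed.

(** After deleting one vertex, [x] or [y] is still there to connect the two parts. *)
Lemma biconnected_setU (A B : {set V}) x y : x != y ->
  x \in A -> x \in B -> y \in A -> y \in B ->
  biconnected E A -> biconnected E B -> biconnected E (A :|: B).
Proof.
move=> nxy xA xB yA yB /andP[cA /forallP dA] /andP[cB /forallP dB].
apply/andP; split; first exact: connected_in_setU xA xB cA cB.
apply/forallP=> v; have -> : (A :|: B) :\ v = (A :\ v) :|: (B :\ v) by rewrite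
  setDUl.
have [xv | nxv] := eqVneq x v.
  by apply: (@connected_in_setU _ _ y); rewrite // !inE -xv eq_sym nxy ?yA ?yB.
by apply: (@connected_in_setU _ _ x); rewrite // !inE nxv ?xA ?xB.
Qed.

Lemma path_within (A : {set V}) x p :
  path E x p -> {subset x :: p <= A} -> connect (within A) x (last x p).
Proof.
elim: p x => //= y p IH x /andP[xy yp] sub.
have [xA yA] : x \in A /\ y \in A by split; apply: sub; rewrite !inE eqxx ?orbT.
apply: connect_trans (IH _ yp _); last by move=> z zp; apply: sub;
  rewrite inE zp orbT.
by apply: connect1; rewrite /within /= xA yA /underlying /= xy.
Qed.

(** Deleting [u] leaves at most two pieces of the path, each still containing an end. *)
Lemma path_avoid (A : {set V}) s p u x :
  path E s p -> uniq (s :: p) -> {subset s :: p <= A} ->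
  x \in s :: p -> x != u ->
  (s != u /\ connect (within (A :\ u)) s x) \/
  (last s p != u /\ connect (within (A :\ u)) x (last s p)).
Proof.
move=> sp Up sub xp nxu; case/splitPl: xp sp Up sub => p1 p2 px.
rewrite cat_path last_cat px => /andP[sp1 xp2] Up sub.
have subD r : {subset r <= s :: p1 ++ p2} -> u \notin r -> {subset r <= A :\ u}.
  move=> rs ur z zr; rewrite in_setD1 sub ?rs // andbT.
  by apply: contraTneq zr => ->.
have [up1 | nup1] := boolP (u \in s :: p1); [right | left].
  have nu : u \notin x :: p2.
    rewrite inE negb_or eq_sym nxu; apply: contraTN up1 => up2.
    move: Up; rewrite -cat_cons cat_uniq => /and3P[_ /hasPn/(_ u up2) + _].
    by [].
  split; first by apply: contraNneq nu => <-; apply: mem_last.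
  apply: path_within => //; apply: subD => // z.
  rewrite -cat_cons mem_cat inE => /orP[/eqP-> | ->]; last by rewrite orbT.
  by rewrite -px mem_last.
split; first by apply: contraNneq nup1 => <-; apply: mem_head.
rewrite -px; apply: path_within => //; apply: subD => // z zp.
by rewrite -cat_cons mem_cat zp.
Qed.

(** After deleting [u] every vertex still reaches [s] or [h]; if both survive, the path avoiding [u]
    connects them. *)
Lemma cycle_biconnected s h p q :
  path E s p -> last s p = h -> uniq (s :: p) ->
  path E s q -> last s q = h -> uniq (s :: q) ->
  (forall u, u \in s :: p -> u \in s :: q -> u = s \/ u = h) ->
  biconnected E [set u in (s :: p) ++ (s :: q)].
Proof.
move=> sp hp Up sq hq Uq disj; set A := [set u in _].
have subp : {subset s :: p <= A} by move=> u up; rewrite inE mem_cat up.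
have subq : {subset s :: q <= A} by move=> u uq; rewrite inE mem_cat uq orbT.
have hub (B : {set V}) c : {in B, forall x, connect (within B) x c} ->
  connected_in E B.
  move=> toc; apply/connected_inP=> x y /toc xc /toc.
  by rewrite within_connect_sym; apply: connect_trans.
apply/andP; split.
  apply: (hub A s) => x; rewrite inE mem_cat => /orP[] xp;
    rewrite within_connect_sym.
    case/splitPl: xp sp subp => p1 p2 <-; rewrite cat_path => /andP[sp1 _] subp.
    by apply: path_within sp1 _ => z zp; apply: subp;
      rewrite -cat_cons mem_cat zp.
  case/splitPl: xp sq subq => p1 p2 <-; rewrite cat_path => /andP[sp1 _] subq.
  by apply: path_within sp1 _ => z zp; apply: subq;
    rewrite -cat_cons mem_cat zp.
apply/forallP=> u.
have alt x : x \in A :\ u ->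
  (s != u /\ connect (within (A :\ u)) s x) \/
  (h != u /\ connect (within (A :\ u)) x h).
  rewrite in_setD1 inE mem_cat => /andP[nxu /orP[xp | xq]].
    by rewrite -hp; apply: (path_avoid sp Up subp xp nxu).
  by rewrite -hq; apply: (path_avoid sq Uq subq xq nxu).
have [esu | nsu] := eqVneq s u.
  apply: (hub _ h) => x /alt [[] | []] //; by rewrite esu eqxx.
have [ehu | nhu] := eqVneq h u.
  apply: (hub _ s) => x /alt [[_ sx] | []]; last by rewrite ehu eqxx.
  by rewrite within_connect_sym.
have sh : connect (within (A :\ u)) s h.
  have [uq | nuq] := boolP (u \in s :: q).
    rewrite -hp; apply: path_within => // z zp; rewrite in_setD1 subp // andbT.
    apply: contraTneq zp => ->; apply/negP=> up.
    by have [eu|eu] := disj u up uq;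
      [rewrite eu eqxx in nsu | rewrite eu eqxx in nhu].
  rewrite -hq; apply: path_within => // z zq; rewrite in_setD1 subq // andbT.
  by apply: contraTneq zq => ->.
apply: (hub _ s) => x /alt [[_] | [_ xh]]; rewrite within_connect_sym //.
by apply: connect_trans sh _; rewrite within_connect_sym.
Qed.

End Biconnected.

(** * Galls and common descendants in a galled tree *)

Section GalledTree.
Variables (V : finType) (E : rel V) (X : {set V}) (rt : V).
Hypothesis acyc : acyclic E.
Hypothesis rt_indeg : indeg E rt = 0.
Hypothesis rt_uniq : forall v, indeg E v = 0 -> v = rt.
Hypothesis leafE : forall x, x \in X <-> outdeg E x = 0 /\ indeg E x = 1.
Hypothesis innerE : forall v, v != rt -> v \notin X ->
  (indeg E v = 1 /\ 2 <= outdeg E v) \/ (indeg E v = 2 /\ 1 <= outdeg E v).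
Hypothesis one_hybrid : forall C, biconnected_component E C ->
  #|[set h in C | hybrid E h & [set u | E u h] \subset C]| <= 1.

Lemma connect_anti u v : connect E u v -> connect E v u -> u = v.
Proof.
case/connectP=> -[|c p] /=; first by move=> _ ->.
case/andP=> uc cp defv vu; have /negP[] := acyc uc.
by apply: connect_trans vu; apply/connectP; exists p.
Qed.

Lemma path_connect s p u : path E s p -> u \in s :: p ->
  connect E s u /\ connect E u (last s p).
Proof.
move=> sp us; case/splitPl: us sp => p1 p2 <-;
  rewrite cat_path last_cat => /andP[sp1 sp2].
by split; apply/connectP; [exists p1 | exists p2].
Qed.

Lemma path_uniq s p : path E s p -> uniq (s :: p).
Proof.
elim: p s => //= v p IH s /andP[sv vp]; rewrite IH // andbT.
apply/negP=> sp; have [vs _] := path_connect vp sp.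
by have /negP[] := acyc sv.
Qed.

Lemma connect_parent u v : connect E u v -> u != v ->
  exists2 w, E w v & connect E u w.
Proof.
case/connectP=> p; case/lastP: p => [|p w] /=; first by move=> _ ->;
  rewrite eqxx.
rewrite rcons_path last_rcons => /andP[up lw] -> _; exists (last u p) => //.
by apply/connectP; exists p.
Qed.

(** Passing to a parent shrinks the set of ancestors, and only the root has no parent. *)
Lemma root_connect v : connect E rt v.
Proof.
have [n] := ubnP #|[set u | connect E u v]|; elim: n v => // n IH v le.
have [-> | nv] := eqVneq v rt; first exact: connect0.
have : [set u | E u v] != set0.
  rewrite -card_gt0 lt0n; apply: contra nv => /eqP/rt_uniq->; exact: eqxx.
case/set0Pn=> w; rewrite inE => wv.
apply: connect_trans (connect1 wv); apply: IH.
rewrite -ltnS; apply: leq_trans le; rewrite ltnS; apply: proper_card;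
  apply/properP; split.
  by apply/subsetP=> u; rewrite !inE => uw;
    apply: connect_trans uw (connect1 wv).
by exists v; rewrite !inE ?connect0 // acyc.
Qed.

Lemma indeg_ge2 v p q : E p v -> E q v -> p != q ->
  hybrid E v /\ [set u | E u v] = [set p; q].
Proof.
move=> pv qv npq.
have sub : [set p; q] \subset [set u | E u v].
  by apply/subsetP=> u /set2P[]->; rewrite inE.
have ge2 : 1 < indeg E v by rewrite -[2](_ : #|[set p;
  q]| = 2) ?subset_leq_card // cards2 npq.
have nrt : v != rt by apply: contraTneq ge2 => ->; rewrite rt_indeg.
have nX : v \notin X.
  by apply/negP=> /leafE[_ i1]; rewrite i1 in ge2.
have [[i1 _] | [i2 o1]] := innerE nrt nX; first by rewrite i1 in ge2.
split; first by rewrite /hybrid i2 eqxx.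
apply/esym/eqP; rewrite eqEcard sub cards2 npq; move: i2; rewrite /indeg => ->.
by [].
Qed.

Definition gall (h : V) (C : {set V}) : Prop :=
  [/\ biconnected E C, h \in C, hybrid E h & [set u | E u h] \subset C].

(** Two shared vertices make the union biconnected, so both hybrid vertices and their parents lie in
    one biconnected component, and (N4) applies. *)
Lemma gall_uniq h h' C C' x y : gall h C -> gall h' C' -> x != y ->
  x \in C -> x \in C' -> y \in C -> y \in C' -> h = h'.
Proof.
move=> [bC hC hyb pC] [bC' hC' hyb' pC'] nxy xC xC' yC yC'.
have bU := biconnected_setU nxy xC xC' yC yC' bC bC'.
have [K maxK /subsetP UK] := maxset_exists bU.
have /card_le1_eqP eqK := one_hybrid maxK.
apply/esym/eqK; rewrite in_set; apply/and3P; split=> //.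
- by apply: UK; rewrite inE hC.
- by apply/subsetP=> u uh; apply: UK; rewrite inE (subsetP pC).
- by apply: UK; rewrite inE hC' orbT.
- by apply/subsetP=> u uh; apply: UK; rewrite inE (subsetP pC') ?orbT.
Qed.

Definition incomparable u v : bool := ~~ connect E u v && ~~ connect E v u.

Lemma two_paths_gall s h p q a b :
  path E s p -> last s p = h -> path E s q -> last s q = h ->
  (forall u, u \in s :: p -> u \in s :: q -> u = s \/ u = h) ->
  a \in s :: p -> b \in s :: q -> E a h -> E b h -> a != b ->
  gall h [set u in (s :: p) ++ (s :: q)].
Proof.
move=> sp hp sq hq disj ap bq ah bh nab; have [hyb par] := indeg_ge2 ah bh nab.
split=> //.
- exact: cycle_biconnected sp hp (path_uniq sp) sq hq (path_uniq sq) disj.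
- by rewrite inE mem_cat -hp mem_last.
- by rewrite par; apply/subsetP=> u /set2P[]->;
    rewrite inE mem_cat ?ap ?bq ?orbT.
Qed.

(* The cycle runs from a lowest common ancestor of [v] and [w] to a highest
   common descendant above [z]. *)
Lemma merge v w z : incomparable v w -> connect E v z -> connect E w z ->
  exists h C, [/\ gall h C, connect E h z, connect E v h /\ v != h,
    connect E w h /\ w != h & [/\ v \in C, w \in C & exists2 p,
      E p v & p \in C]].
Proof.
case/andP=> nvw nwv vz wz.
(* The number of descendants drops strictly on the way down, so its extrema pick out the lowest [s]
   and the highest [h]. *)
pose D u := #|[set x | connect E u x]|.
have Dle a b : connect E a b -> D b <= D a ?= iff (a == b).
  move=> ab; split.
    by apply: subset_leq_card; apply/subsetP=> x; rewrite !inE;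
      apply: connect_trans.
  apply/eqP/eqP=> [eqD | -> //]; apply: (connect_anti ab).
  have /eqP/setP/(_ a) : [set x | connect E b x] == [set x | connect E a x].
    rewrite eqEcard; move: eqD; rewrite /D => ->; rewrite leqnn andbT.
    by apply/subsetP=> x; rewrite !inE; apply: connect_trans.
  by rewrite !inE connect0.
have Pr : connect E rt v && connect E rt w by rewrite !root_connect.
have Pz : [&& connect E v z,
  connect E w z & connect E z z] by rewrite vz wz connect0.
have [s /andP[sv sw] mins] :=
  @arg_minnP _ rt (fun s => connect E s v && connect E s w) D Pr.
have [h /and3P[vh wh hz] maxh] :=
  @arg_maxnP _ z (fun h => [&& connect E v h,
    connect E w h & connect E h z]) D Pz.
have lows u : connect E s u -> connect E u v -> connect E u w -> u = s.
  move=> su uv uw; have [le iff] := Dle _ _ su.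
  by apply/eqP; rewrite eq_sym -iff eqn_leq le mins ?uv.
have toph u : connect E v u -> connect E w u -> connect E u h -> u = h.
  move=> vu wu uh; have [le iff] := Dle _ _ uh.
  apply/eqP; rewrite -iff eqn_leq le; apply: maxh.
  by rewrite vu wu (connect_trans uh hz).
have nvh : v != h by apply: contraNneq nwv => ->.
have nwh : w != h by apply: contraNneq nvw => ->.
have nsv : s != v by apply: contraNneq nvw => <-.
have nsw : s != w by apply: contraNneq nwv => <-.
have thru a : connect E s a -> connect E a h -> exists p,
    [/\ path E s p, last s p = h, a \in s :: p &
      forall u, u \in s :: p -> connect E s u /\ (connect E u a \/ connect E a
        u /\ connect E u h)].
  case/connectP=> p1 sp1 da; case/connectP=> p2 ap2 dh; exists (p1 ++ p2).
  have sa : connect E s a by apply/connectP; exists p1.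
  split; first by rewrite cat_path sp1 -da.
  - by rewrite last_cat -da dh.
  - by rewrite -cat_cons mem_cat {1}da mem_last.
  move=> u; rewrite -cat_cons mem_cat => /orP[up1 | up2].
    by have [su ua] := path_connect sp1 up1; rewrite -da in ua; auto.
  have up2' : u \in a :: p2 by rewrite inE up2 orbT.
  have [au uh] := path_connect ap2 up2'; rewrite -dh in uh.
  by split; [apply: connect_trans au | right].
have [p [sp hp vp inp]] := thru v sv vh.
have [q [sq hq wq inq]] := thru w sw wh.
(* A shared vertex above both [v] and [w] is [s], one below both is [h]; any other position makes
   [v] and [w] comparable. *)
have disj u : u \in s :: p -> u \in s :: q -> u = s \/ u = h.
  move=> /inp[su up] /inq[_ uq].
  case: up uq => [uv | [vu uh]] [uw | [wu _]]; [left | | | right].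
  - exact: lows.
  - by case/negP: nwv; apply: connect_trans wu uv.
  - by case/negP: nvw; apply: connect_trans vu uw.
  - exact: toph.
have parent_on a r : path E s r -> a \in s :: r -> s != a ->
    exists2 c, E c a & c \in s :: r.
  move=> sr ar nsa; have ar' : a \in r by rewrite inE eq_sym (negPf nsa) in ar.
  case/splitPr: ar' sr {ar} => r1 r2;
    rewrite cat_path => /andP[sr1 /= /andP[ca _]].
  by exists (last s r1) => //; rewrite -cat_cons mem_cat mem_last.
have nsh : s != h.
  by apply: contraNneq nvh => esh; apply/eqP; apply: connect_anti vh _;
    rewrite -esh.
have last_parent r : path E s r -> last s r = h -> exists c,
    [/\ E c h, c \in s :: r & forall u, u \in s :: r -> u != h ->
      connect E u c].
  case/lastP: r => [|r x]; first by move=> _ /= esh; rewrite esh eqxx in nsh.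
  rewrite rcons_path last_rcons => /andP[sr rx] <-; exists (last s r).
  split=> //; first by rewrite -rcons_cons mem_rcons inE mem_last orbT.
  move=> u; rewrite -rcons_cons mem_rcons inE => /orP[/eqP->|ur _];
    first by rewrite eqxx.
  by have [] := path_connect sr ur.
have [a [ah ap va]] := last_parent p sp hp.
have [b [bh bq wb]] := last_parent q sq hq.
have nha : a != h by apply: contraTneq ah => ->; apply/negP=> /acyc;
  rewrite connect0.
(* A common last parent would be a common descendant of [v] and [w] strictly above [h]. *)
have nab : a != b.
  apply: contraNneq nha => eab; apply/eqP; apply: toph (connect1 ah);
    first exact: va.
  by rewrite eab; apply: wb.
exists h, [set u in (s :: p) ++ (s :: q)]; split=> //.
  exact: two_paths_gall sp hp sq hq disj ap bq ah bh nab.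
split; [by rewrite inE mem_cat vp | by rewrite inE mem_cat wq orbT |].
have [c cv cp] := parent_on v p sp vp nsv.
by exists c; rewrite // inE mem_cat cp.
Qed.

(** If one parent reaches the other, that path and the direct edge close a cycle. Otherwise [merge]
    gives a hybrid vertex above [v] and properly below both parents, which must be [v]. *)
Lemma hybrid_gall v p q : E p v -> E q v -> p != q ->
  exists C, [/\ gall v C, v \in C, p \in C & q \in C].
Proof.
move=> pv qv npq; have [_ par] := indeg_ge2 pv qv npq.
suff [C gC] : exists C, gall v C.
  have [_ vC _ /subsetP pC] := gC.
  by exists C; split=> //; apply: pC; rewrite inE.
have shortcut a b : E a v -> E b v -> a != b -> connect E a b ->
  exists C, gall v C.
  move=> av bv nab /connectP[r ar db];
    exists [set u in (a :: rcons r v) ++ [:: a; v]].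
  apply: (@two_paths_gall _ _ _ _ b a) => //=.
  - by rewrite rcons_path ar -db.
  - by rewrite last_rcons.
  - by rewrite av.
  - by move=> u _; rewrite !inE => /orP[] /eqP; auto.
  - by rewrite db -rcons_cons mem_rcons inE mem_last orbT.
  - by rewrite inE eqxx.
  - by rewrite eq_sym.
have [pq | npq'] := boolP (connect E p q); first exact: shortcut pv qv npq pq.
have [qp | nqp] := boolP (connect E q p); first by apply: shortcut qv pv _ qp;
  rewrite eq_sym.
have inc : incomparable p q by rewrite /incomparable npq'.
have [h [C [gC hv [ph nph] [qh nqh] _]]] :=
  merge inc (connect1 pv) (connect1 qv).
exists C; have [<- // | nhv] := eqVneq h v.
have [w wv hw] := connect_parent hv nhv.
have : w \in [set u | E u v] by rewrite inE.
rewrite par => /set2P[] ew; rewrite ew in hw.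
  by case/eqP: nph; apply: connect_anti.
by case/eqP: nqh; apply: connect_anti.
Qed.

(* If [v] were itself a hybrid vertex, its own gall would share [v] and a
   parent of [v] with the gall of [h], forcing [v = h]. *)
Lemma overlap_descendant v w w' x y : incomparable v w -> incomparable v w' ->
  connect E v x -> connect E w x -> connect E v y -> connect E w' y ->
  connect E w' x.
Proof.
move=> iw iw' vx wx vy w'y.
have [h [C [gC hx [vh nvh] _ [vC _ [p pv pC]]]]] := merge iw vx wx.
have [h' [C' [gC' _ _ [wh' _] [vC' _ [p' pv' pC']]]]] := merge iw' vy w'y.
have npv : p != v by apply: contraTneq pv => ->; apply/negP=> /acyc;
  rewrite connect0.
(* With a common parent the two galls share two vertices, so [h = h']; this vertex is reached by
   [w'] and reaches [x]. *)
have [epp | npp] := eqVneq p p'.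
  rewrite -epp in pC'; have eh : h = h' := gall_uniq gC gC' npv pC pC' vC vC'.
  by apply: connect_trans wh' _; rewrite -eh.
have [C0 [gC0 vC0 pC0 _]] := hybrid_gall pv pv' npp.
have eh : v = h := gall_uniq gC0 gC npv pC0 pC vC0 vC.
by rewrite eh eqxx in nvh.
Qed.

(** Each common descendant lies below the hybrid vertex of a gall through [v] and [w], and all such
    galls have the same hybrid vertex. *)
Lemma descendants_cap v w z : incomparable v w -> connect E v z ->
  connect E w z ->
  exists h, [/\ hybrid E h, v != h, w != h &
    forall x, connect E v x && connect E w x = connect E h x].
Proof.
move=> iw vz wz.
have nvw : v != w by case/andP: iw => nvw _; apply: contraNneq nvw => ->;
  rewrite connect0.
have [h [C [gC hz [vh nvh] [wh nwh] [vC wC _]]]] := merge iw vz wz.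
exists h; split=> //; first by case: gC.
move=> x; apply/andP/idP=> [[vx wx] | hx]; last by split;
  apply: connect_trans hx.
have [h' [C' [gC' hx' _ _ [vC' wC' _]]]] := merge iw vx wx.
by rewrite (gall_uniq gC gC' nvw vC vC' wC wC').
Qed.

Lemma incomparable_sym u v : incomparable u v = incomparable v u.
Proof. by rewrite /incomparable andbC. Qed.

(* Two of the three vertices reach the gall's hybrid vertex through the same
   parent, which then is a common descendant above it. *)
Lemma no_three_overlapping u v w x y z :
  incomparable u v -> incomparable u w -> incomparable v w ->
  connect E u x -> connect E v x -> connect E u y -> connect E w y ->
  connect E v z -> connect E w z -> False.
Proof.
move=> iuv iuw ivw ux vx uy wy vz wz.
have ivu : incomparable v u by rewrite incomparable_sym.
have uv_w a : connect E u a -> connect E v a -> connect E w a.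
  by move=> ua va; apply: overlap_descendant iuv iuw ua va uy wy.
have uw_v a : connect E u a -> connect E w a -> connect E v a.
  by move=> ua wa; apply: overlap_descendant iuw iuv ua wa ux vx.
have vw_u a : connect E v a -> connect E w a -> connect E u a.
  by move=> va wa; apply: overlap_descendant ivw ivu va wa vx ux.
have [h [hyb nuh nvh hE]] := descendants_cap iuv ux vx.
have [p [q [_ par]]] : exists p q, p != q /\ [set c | E c h] = [set p; q].
  by apply/cards2P; case/andP: hyb.
have /andP[uh vh] : connect E u h && connect E v h by rewrite hE.
have wh := uv_w h uh vh.
have nwh : w != h by apply: contraTneq iuw => ->; rewrite /incomparable uh.
have reach a : connect E a h -> a != h ->
    connect E a p && E p h \/ connect E a q && E q h.
  move=> ah nah; have [b bh ab] := connect_parent ah nah.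
  have : b \in [set c | E c h] by rewrite inE.
  by rewrite par => /set2P[] eb; rewrite -eb ab bh; auto.
(* By [hE] such a parent [b] of [h] would also lie below [h], closing a directed cycle. *)
have no b : E b h -> connect E u b -> connect E v b -> False.
  move=> bh ub vb; have /negP[] := acyc bh.
  by rewrite -hE ub.
case: (reach u uh nuh) => /andP[ua ah]; case: (reach v vh nvh) => /andP[va bh];
  case: (reach w wh nwh) => /andP[wa ch].
- exact: no ah ua va.
- exact: no ah ua va.
- exact: no ah ua (uw_v _ ua wa).
- exact: no bh (vw_u _ va wa) va.
- exact: no bh (vw_u _ va wa) va.
- exact: no ah ua (uw_v _ ua wa).
- exact: no ah ua va.
- exact: no ah ua va.
Qed.

(** * Leaf clusters form a gall system *)

Section Clusters.
Variables (T : finType) (phi : T -> V) (e : rel T).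
Hypothesis phi_inj : injective phi.
Hypothesis phiX : forall x, phi x \in X.
Hypothesis e_lca : forall x y x' y',
  (forall v, common_ancestor E (phi x) (phi y) v = common_ancestor E (phi x')
    (phi y') v) ->
  e x y = e x' y'.

Definition cluster (v : V) : {set T} := [set x | connect E v (phi x)].

Lemma overlap_incomparable v w : overlap (cluster v) (cluster w) ->
  exists2 z, incomparable v w & connect E v (phi z) /\ connect E w (phi z).
Proof.
case/and3P=> /set0Pn[z /setIP[]]; rewrite !inE => vz wz nvw nwv; exists z => //.
apply/andP; split; [apply: contra nwv | apply: contra nvw] => vw;
  apply/subsetP=> x;
  by rewrite !inE; apply: connect_trans.
Qed.

(** The root yields the full set and leaves yield singletons. Overlapping clusters belong to
    incomparable vertices, and the clusters containing a pair record its common ancestors. *)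
Lemma cluster_gall_system : gall_system e [set: T] [set cluster v | v : V].
Proof.
split.
- by move=> A _; apply: subsetT.
- apply/imsetP; exists rt => //; apply/setP=> x; rewrite !inE root_connect //.
- move=> x _; apply/imsetP; exists (phi x) => //; apply/setP=> y; rewrite !inE.
  apply/eqP/idP=> [-> | /connectP[[|c p]] /=]; first exact: connect0.
    by move=> _ /phi_inj.
  case/andP=> xc _ _; have /leafE[/eqP + _] := phiX x.
  by rewrite /outdeg cards_eq0 => /eqP/setP/(_ c); rewrite !inE xc.
- move=> _ _ /imsetP[v _ ->] /imsetP[w _ ->] /set0Pn[z /setIP[]];
    rewrite !inE => vz wz.
  have [vw | nvw] := boolP (connect E v w).
    apply/imsetP; exists w => //; apply/setIidPr/subsetP=> x; rewrite !inE.
    exact: connect_trans.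
  have [wv | nwv] := boolP (connect E w v).
    apply/imsetP; exists v => //; apply/setIidPl/subsetP=> x; rewrite !inE.
    exact: connect_trans.
  have inc : incomparable v w by rewrite /incomparable nvw.
  have [h [_ _ _ hE]] := descendants_cap inc vz wz.
  by apply/imsetP; exists h => //; apply/setP=> x; rewrite !inE hE.
- move=> _ _ _ /imsetP[v _ ->] /imsetP[w _ ->] /imsetP[w' _ ->].
  case/overlap_incomparable=> z iw [vz wz];
    case/overlap_incomparable=> z' iw' [vz' wz'].
  apply/setP=> x; rewrite !inE; apply: andb_id2l => vx.
  apply/idP/idP=> ?; first exact: overlap_descendant iw iw' _ _ vz' wz'.
  exact: overlap_descendant iw' iw _ _ vz wz.
- move=> _ _ _ /imsetP[v _ ->] /imsetP[w _ ->] /imsetP[w' _ ->].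
  case/overlap_incomparable=> z iw [vz wz];
    case/overlap_incomparable=> z' iw' [vz' wz'].
  apply/negP=> /overlap_incomparable[y iww [wy wy']].
  exact: no_three_overlapping iw iw' iww vz wz vz' wz' wy wy'.
- move=> x y x' y' _ _ _ _ eqA; apply: e_lca => v.
  have Fv : cluster v \in [set cluster v | v : V] by apply: imset_f.
  by have := eqA _ Fv; rewrite !inE.
Qed.

End Clusters.
End GalledTree.

(** The lca of two leaves, and with it their adjacency, depends only on the set of common ancestors;
    the cluster system is then traced on [S]. *)
Lemma GaTEx_decomposable (T : finType) (e : rel T) :
  GaTEx e -> forall S : {set T}, 1 < #|S| -> decomposable e S.
Proof.
case=> V [E [X [t [g [[[_ acyc tree] _] expl [f [bij_f ef]]]]]]] S S2.
pose phi x := val (f x).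
have phi_inj : injective phi by move=> x y /val_inj/(bij_inj bij_f).
case: tree => [[r [VE _ _]] | [rt [[rt0 _ rt_uniq] leafE innerE one_hyb]]].
  have /card_gt1P[x [y [_ _ /eqP[]]]] := S2; apply: phi_inj.
  have sing z : phi z = r by apply/set1P; rewrite -VE.
  by rewrite !sing.
have phiX x : phi x \in X by apply: valP.
have e_lca x y x' y' :
    (forall v, common_ancestor E (phi x) (phi y) v = common_ancestor E (phi x')
      (phi y') v) ->
    e x y = e x' y'.
  move=> eqca; rewrite !ef.
  have lcaE v : is_lca E (phi x) (phi y) v <-> is_lca E (phi x') (phi y') v.
    by rewrite /is_lca eqca; split=> -[ca low]; split=> // w;
       [rewrite -eqca | rewrite eqca]; apply: low.
  apply/idP/idP=> /expl[v [/lcaE lv tv]]; apply/expl; exists v; split=> //;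
    exact/lcaE.
have sys := cluster_gall_system acyc rt0 rt_uniq leafE innerE one_hyb phi_inj
  phiX e_lca.
exact: gall_system_decomposable (gall_system_trace (subsetT S) sys) S2.
Qed.

Theorem mainTheorem15 (T : finType) (e : rel T)
    (e_sym : symmetric e) (e_irr : irreflexive e) :
  GaTEx e -> ~ contains_induced house e ->
  [/\ Meyniel e, very_strongly_perfect e & brittle e].
Proof.
move=> /GaTEx_decomposable dec nohouse.
have nm := exists_nonmidpoint e_sym e_irr dec.
split.
- exact: house_free_Meyniel.
- exact: decomposable_very_strongly_perfect.
- exact: nonmidpoint_brittle.
Qed.
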